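(* Let $m\ge 2$ be an integer. Let $H_1,\ldots,H_m$ be connected graphs with pairwise disjoint vertex sets, at least one of which has an edge, with $|V(H_i)|\le 6$ for all $i$. Let $x_i\in V(H_i)$ for $i=1,\ldots,m$, and set $\mathcal{H}=\{H_1,\ldots,H_m\}$ and $X_{[m]}=\{x_1,\ldots,x_m\}$. Then the following conditions are equivalent: (1) For all $i$, $H_i$ is 2-pure with respect to $x_i$ and $H_i$ is vertex decomposable such that $x_i$ is a shedding vertex. (2) The rooted product $G_0(\mathcal{H})$ is pure vertex decomposable for every graph $G_0$ on $X_{[m]}$. (3) $G_0(\mathcal{H})$ is Cohen--Macaulay for every graph $G_0$ on $X_{[m]}$. (4) $G_0(\mathcal{H})$ satisfies Serre's condition $(S_2)$ for every graph $G_0$ on $X_{[m]}$.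
   Context: All graphs are finite, simple and undirected. Fix an arbitrary field $\Bbbk$. For a graph $G$, let $S=\Bbbk[V(G)]$, and let $I(G)=(xy : \{x,y\}\in E(G))\subset S$ be the edge ideal. $G$ is Cohen--Macaulay (resp. satisfies Serre's condition $(S_r)$) if $S/I(G)$ is Cohen--Macaulay (resp. satisfies $\operatorname{depth} M_{\mathfrak p}\ge\min\{r,\dim M_{\mathfrak p}\}$ for all primes $\mathfrak p$, with $M=S/I(G)$). Rooted product: for a graph $G_0$ on the vertex set $X_{[m]}$, $G_0(\mathcal{H})$ is the graph with vertex set $\bigcup_{i=1}^m V(H_i)$ and edge set $E(G_0)\cup\bigcup_{i=1}^m E(H_i)$. The independence complex $\Delta(G)$ is the simplicial complex of independent sets of $G$. $G$ is pure (equivalently, well-covered) if all maximal independent sets of $G$ have the same cardinality. $G-x$ is $G$ with the vertex $x$ deleted. $G$ is 2-pure with respect to a vertex $x$ if $G$ is pure, $G-x$ is pure, and $\dim S/I(G)=\dim S/(I(G)+(x))$. A simplicial complex $\Delta$ is vertex decomposable if it is a simplex, or $\Delta=\emptyset$, or there is a vertex $x$ such that (a) $\operatorname{link}_\Delta(\{x\})$ and $\operatorname{del}_\Delta(\{x\})=\{F\in\Delta:x\notin F\}$ are vertex decomposable and (b) every facet of $\operatorname{del}_\Delta(\{x\})$ is a facet of $\Delta$; a vertex $x$ satisfying (a) and (b) is called a shedding vertex. These notions apply to a graph via its independence complex. ''Pure vertex decomposable'' means pure and vertex decomposable. *)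

(* Defs.v *)
From HB Require Import structures.
From mathcomp Require Import all_boot all_order all_algebra.

Set Implicit Arguments.
Unset Strict Implicit.
Unset Printing Implicit Defensive.

Record sgraph (V : finType) := SGraph {
  adj :> rel V;
  adj_sym : symmetric adj;
  adj_irr : irreflexive adj }.

Section Complexes.
Variable V : finType.
Implicit Types (D : {set {set V}}) (F : {set V}) (x : V).

Definition facet D F : bool := maxset (fun A => A \in D) F.

Definition pure_complex D : Prop :=
  forall F F', facet D F -> facet D F' -> #|F| = #|F'|.

Definition link D x : {set {set V}} :=
  [set F : {set V} | (x \notin F) && (x |: F \in D)].

Definition del D x : {set {set V}} := [set F : {set V} in D | x \notin F].

Inductive vertex_decomposable D : Prop :=
| VDsimplex F of D = powerset F
| VDempty of D = set0
| VDshed x of [set x] \in D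
    & vertex_decomposable (link D x) & vertex_decomposable (del D x)
    & (forall F, facet (del D x) F -> facet D F).

Definition shedding_vertex D x : Prop :=
  [/\ [set x] \in D, vertex_decomposable (link D x),
      vertex_decomposable (del D x)
    & forall F, facet (del D x) F -> facet D F].

End Complexes.

Section Graphs.
Variables (V : finType) (G : sgraph V).

Definition graph_connected : Prop := forall u v, connect G u v.

Definition independent (A : {set V}) : bool :=
  [forall u in A, forall v in A, ~~ G u v].

Definition indep_complex : {set {set V}} := [set A | independent A].

Definition graph_pure : Prop := pure_complex indep_complex.

Definition del_vertex_adj (x : V) : rel {v : V | v != x} :=
  fun u v => G (val u) (val v).

Lemma del_vertex_sym (x : V) : symmetric (del_vertex_adj (x := x)).
Proof. by move=> u v; exact: adj_sym. Qed.

Lemma del_vertex_irr (x : V) : irreflexive (del_vertex_adj (x := x)).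
Proof. by move=> u; exact: adj_irr. Qed.

Definition del_vertex (x : V) : sgraph {v : V | v != x} :=
  SGraph (@del_vertex_sym x) (@del_vertex_irr x).

End Graphs.

(* The vertex sets are made disjoint by tagging, and x_i in X_[m] is
   represented by its index i in G0. *)
Section RootedProduct.
Variables (m : nat) (V : 'I_m -> finType).
Variables (G0 : sgraph 'I_m) (H : forall i, sgraph (V i)) (x : forall i, V i).

Definition rooted_adj : rel {i : 'I_m & V i} := fun u v =>
  [|| (tag u == tag v) && H (tag u) (tagged u) (tagged_as u v)
    | [&& tagged u == x (tag u), tagged v == x (tag v) & G0 (tag u) (tag v)]].

Lemma rooted_sym : symmetric rooted_adj.
Proof.
move=> [i u] [j v]; rewrite /rooted_adj /= [G0 j i]adj_sym [RHS]orbC andbCA orbC.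
congr (_ || _); case: (eqVneq i j) => [eij|//].
by case: _ / eij v => v; rewrite !tagged_asE adj_sym.
Qed.

Lemma rooted_irr : irreflexive rooted_adj.
Proof.
by move=> [i u]; rewrite /rooted_adj /= tagged_asE !adj_irr !andbF.
Qed.

Definition rooted_product : sgraph {i : 'I_m & V i} :=
  SGraph rooted_sym rooted_irr.

End RootedProduct.

From mathcomp Require Import boolp classical_sets.
From mathcomp Require Import mpoly.

Import GRing.Theory.

Local Open Scope ring_scope.

Local Notation "x %:F" := (tofrac x) : ring_scope.

Section Ideals.
Variable A : comNzRingType.
Local Open Scope classical_set_scope.

(* Unlike [idealr_closed] of [ring_quotient], this allows the unit ideal. *)
Definition ideal (J : set A) : Prop :=
  [/\ J 0, forall a b, J a -> J b -> J (a + b) & forall a b, J b -> J (a * b)].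

Definition ideal_gen (X : set A) : set A := smallest ideal X.

(* In the following, J stands for the cyclic A-module M = A/J, and the
   extended naturals dim M and depth M are given through their lower bounds.
   M = 0 (that is, 1 \in J) satisfies none of these bounds. *)

(* The primes containing J are the support of M. *)
Definition dim_ge (J : set A) (n : nat) : Prop :=
  exists c : nat -> prime_idealr A,
    (forall i, (i <= n)%N -> J `<=` [set` c i]) /\
    (forall i, (i < n)%N -> [set` c i] `<` [set` c i.+1]).

Definition quot_seq (J : set A) (s : seq A) : set A :=
  ideal_gen (J `|` [set` s]).

(* s_i is a nonzerodivisor on M/(s_0,...,s_(i-1))M, and M/(s)M is nonzero. *)
Definition regular_seq (J : set A) (s : seq A) : Prop :=
  (forall i, (i < size s)%N ->
     forall b, quot_seq J (take i s) (s`_i * b) -> quot_seq J (take i s) b) /\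
  ~ quot_seq J s 1.

(* m is meant to be the maximal ideal of a Noetherian local ring A. *)
Definition depth_ge (m J : set A) (n : nat) : Prop :=
  exists s : seq A, [/\ size s = n, [set` s] `<=` m & regular_seq J s].

End Ideals.

(* The localization of an integral domain at a prime ideal, as a subring of
   the field of fractions. *)
Section Localization.
Variables (R : idomainType) (P : prime_idealr R).

Definition local_fracs : {pred {fraction R}} :=
  fun x => `[< exists a s : R, s \notin (P : {pred R}) /\ x = a%:F / s%:F >].

Lemma local_denom_neq0 (s : R) : s \notin (P : {pred R}) -> s%:F != 0.
Proof.
by move=> sP; rewrite tofrac_eq0; apply: contraNneq sP => ->; exact: rpred0.
Qed.

Lemma local_fracs_subring : subring_closed local_fracs.
Proof.
have P1 : 1 \notin (P : {pred R}) by rewrite idealr1.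
have PM s t : s \notin (P : {pred R}) -> t \notin (P : {pred R}) ->
    s * t \notin (P : {pred R}).
  by move=> sP tP; rewrite prime_idealrM negb_or sP.
split=> [|x y /asboolP[a [s [sP ->]]] /asboolP[b [t [tP ->]]]
         |x y /asboolP[a [s [sP ->]]] /asboolP[b [t [tP ->]]]].
- by apply/asboolP; exists 1, 1; rewrite tofrac1 divr1.
- apply/asboolP; exists (a * t - b * s), (s * t); split; first exact: PM.
  by rewrite tofracB !tofracM -mulNr addf_div ?local_denom_neq0 // mulNr.
- apply/asboolP; exists (a * b), (s * t); split; first exact: PM.
  by rewrite !tofracM mulf_div.
Qed.

HB.instance Definition _ :=
  GRing.isSubringClosed.Build {fraction R} local_fracs local_fracs_subring.

Record localization := Localization {
  loc_val :> {fraction R};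
  loc_valP : loc_val \in local_fracs }.

HB.instance Definition _ := [isSub for loc_val].
HB.instance Definition _ := [Choice of localization by <:].
HB.instance Definition _ := [SubChoice_isSubComNzRing of localization by <:].

Lemma tofrac_local (a : R) : a%:F \in local_fracs.
Proof.
by apply/asboolP; exists a, 1; rewrite idealr1 tofrac1 divr1.
Qed.

Definition to_loc (a : R) : localization := Localization (tofrac_local a).

Local Open Scope classical_set_scope.

Definition ideal_loc (J : set R) : set localization :=
  ideal_gen (to_loc @` J).

Definition max_loc : set localization := ideal_loc [set` P].

End Localization.

Arguments to_loc {R} P a.
Arguments ideal_loc {R} P J.
Arguments max_loc {R} P.

Section RingProperties.
Variable R : idomainType.
Local Open Scope classical_set_scope.

(* R/J is Cohen-Macaulay: depth M_p = dim M_p for every prime p of the support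
   of M = R/J (outside of it M_p = 0 and both sides are false). *)
Definition quot_cohen_macaulay (J : set R) : Prop :=
  forall (P : prime_idealr R) (n : nat),
    depth_ge (max_loc P) (ideal_loc P J) n <-> dim_ge (ideal_loc P J) n.

(* depth M_p >= min(r, dim M_p) for every prime p. *)
Definition quot_serre (r : nat) (J : set R) : Prop :=
  forall (P : prime_idealr R) (n : nat),
    (n <= r)%N -> dim_ge (ideal_loc P J) n ->
    depth_ge (max_loc P) (ideal_loc P J) n.

End RingProperties.

Section GraphAlgebra.
Variables (k : fieldType) (V : finType) (G : sgraph V).

Definition vertex_var (v : V) : {mpoly k[#|V|]} := 'X_(enum_rank v).

Local Open Scope classical_set_scope.

Definition edge_gens : set {mpoly k[#|V|]} :=
  [set f | exists u v, G u v /\ f = vertex_var u * vertex_var v].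

Definition edge_ideal : set {mpoly k[#|V|]} := ideal_gen edge_gens.

Definition graph_cohen_macaulay : Prop := quot_cohen_macaulay edge_ideal.

Definition graph_serre (r : nat) : Prop := quot_serre r edge_ideal.

End GraphAlgebra.

Arguments vertex_var k {V} v.
Arguments edge_gens k {V} G.
Arguments edge_ideal k {V} G.

Section TwoPure.
Variables (k : fieldType) (V : finType) (G : sgraph V) (x : V).
Local Open Scope classical_set_scope.

(* dim S/I(G) = dim S/(I(G) + (x)) *)
Definition del_same_dim : Prop :=
  forall n, dim_ge (edge_ideal k G) n <->
            dim_ge (ideal_gen (edge_ideal k G `|` [set vertex_var k x])) n.

Definition two_pure : Prop :=
  [/\ graph_pure G, graph_pure (del_vertex G x) & del_same_dim].

End TwoPure.

(* Main.v *)
Require Import Defs.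
From HB Require Import structures.
From mathcomp Require Import all_boot all_order all_algebra.
From mathcomp Require Import boolp classical_sets mpoly ring zify.

Set Implicit Arguments.
Unset Strict Implicit.
Unset Printing Implicit Defensive.

(* Write X_F for the product of the variables in F, and SR(D) for the
   Stanley-Reisner ideal of a complex D; SR(indep_complex G) is the edge ideal.

   (1) => (2): shed the roots x_i one after the other. Each component is then
   H_i, H_i - x_i or H_i - N[x_i], and once all roots are gone the components
   are disjoint. Purity holds since facets of H_i - x_i are facets of H_i.

   (2) => (3): let P be a prime containing SR(D), let T be a maximal set of
   variables algebraically independent modulo P, and G the set of variables
   outside P. For y in G \ T choose a relation of y over k[T] lying in P. These
   relations, followed by the elementary symmetric polynomials e_d', ..., e_1 of
   the variables in P (d' = d - |G|), form a regular sequence of length d - |T| on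
   the localization at P: the exact sequence
   0 -> S/(SR(D) : x) -> S/SR(D) -> S/(SR(D) + x) -> 0 of a shedding vertex x
   reduces this to simplices. A counting argument bounds the length of chains of
   primes in P above SR(D) by d - |T|.

   (4) => (1): if the complement of a non-clique link is disconnected, the
   localization at the corresponding monomial prime has depth less than 2. Hence,
   for graphs, (S_2) means that non-clique links have connected complements. Links
   of G_0(H) by facets of H_j through x_j, for G_0 empty or a single edge, show
   that H_i and H_i - x_i have this property. It implies purity and, on at most 5
   vertices, vertex decomposability. *)

(** Cohen-Macaulayness is tested at every prime and k may be finite, so neither the homogeneous
    maximal ideal nor generic linear forms suffice. Elementary symmetric polynomials serve over
    every field: modulo the ideal of a simplex the top one is a single monomial with coefficient 1.
    In (4) => (1), once dimensions are read off as face sizes and (S_2) is turned into a condition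
    on links, everything is about graphs. The bound 6 comes from here: the link and the deletion of
    a root have at most 5 vertices. If none of these is isolated, a facet with 3 vertices leaves at
    most 2 others, too few to give its vertices neighbours under (S_2); so independent sets have at
    most 2 vertices, and a complex of this size can be built up vertex by vertex. Connectedness and
    the existence of an edge ensure that every root has a neighbour. A facet through the neighbour
    avoids the root, so H_i and H_i - x_i have facets of equal size, which gives both the equality
    of dimensions and the shedding property. The condition m >= 2 provides a second root, to which
    x_i is joined in order to delete x_i in a link. *)

Import GRing.Theory.

(** * Ideals, primes and dimension *)

Section IdealTheory.
Variable A : comNzRingType.
Implicit Types (J K : set A) (a b : A) (s : seq A).
Local Open Scope ring_scope.
Local Open Scope classical_set_scope.

Lemma idealB J a b : ideal J -> J a -> J b -> J (a - b).
Proof. by case=> _ JD JM Ja Jb; rewrite -mulN1r; apply/JD/JM. Qed.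

Lemma ideal_sum J (I : Type) (r : seq I) (P : pred I) (F : I -> A) :
  ideal J -> (forall i, P i -> J (F i)) -> J (\sum_(i <- r | P i) F i).
Proof. by move=> [J0 JD _] JF; elim/big_ind: _. Qed.

Lemma ideal_gen_ideal (X : set A) : ideal (ideal_gen X).
Proof.
split=> [J [[]] //|a b Xa Xb J JX|a b Xb J JX].
  by case: (JX) => -[_ JD _] _; apply: JD; [exact: Xa|exact: Xb].
by case: (JX) => -[_ _ JM] _; apply: JM; exact: Xb.
Qed.

Lemma prime_ideal (P : prime_idealr A) : ideal [set` P].
Proof.
split=> /= [|a b|a b]; [exact: rpred0|exact: rpredD|exact: idealMr].
Qed.

Lemma ideal_gen_min (X J : set A) : ideal J -> X `<=` J -> ideal_gen X `<=` J.
Proof. exact: smallest_sub. Qed.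

Lemma ideal_gen_id J : ideal J -> ideal_gen J = J.
Proof. exact: smallest_id. Qed.

Definition addi J a : set A := [set f | exists k c, J k /\ f = k + c * a].

Lemma addi_ideal J a : ideal J -> ideal (addi J a).
Proof.
move=> [J0 JD JM]; split=> [|f g [k [c [Jk ->]]] [l [d [Jl ->]]]|f g].
- by exists 0, 0; rewrite mul0r addr0.
- by exists (k + l), (c + d); split; [exact: JD|rewrite mulrDl addrACA].
- by move=> [k [c [Jk ->]]]; exists (f * k), (f * c);
    split; [exact: JM|rewrite mulrDr mulrA].
Qed.

Lemma sub_addi J a : J `<=` addi J a.
Proof. by move=> k Jk; exists k, 0; rewrite mul0r addr0. Qed.

Lemma mem_addi J a : ideal J -> addi J a a.
Proof. by case=> J0 _ _; exists 0, 1; rewrite mul1r add0r. Qed.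

Lemma addi_min J K a : ideal K -> J `<=` K -> K a -> addi J a `<=` K.
Proof.
by move=> [_ KD KM] JK Ka _ [k [c [/JK Kk ->]]]; apply/KD/KM.
Qed.

Lemma ideal_gen_addi J a : ideal J -> ideal_gen (J `|` [set a]) = addi J a.
Proof.
move=> Ji; apply/seteqP; split.
  apply: ideal_gen_min; first exact: addi_ideal.
  by move=> b [/sub_addi //|->]; apply: mem_addi.
apply: addi_min; first exact: ideal_gen_ideal.
  by move=> b Jb; apply: sub_gen_smallest; left.
by apply: sub_gen_smallest; right.
Qed.

Lemma addi_congr J a b : ideal J -> J (a - b) -> addi J a = addi J b.
Proof.
suff sub c d : ideal J -> J (c - d) -> addi J c `<=` addi J d.
  move=> Ji Jab; apply/seteqP; split; apply: sub => //.
  by rewrite -opprB -sub0r; apply: idealB => //; case: Ji.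
move=> Ji Jcd; apply: addi_min; [exact: addi_ideal|exact: sub_addi|].
by exists (c - d), 1; rewrite mul1r subrK.
Qed.

Lemma addiC J a b : ideal J -> addi (addi J a) b = addi (addi J b) a.
Proof.
suff sub c d : ideal J -> addi (addi J c) d `<=` addi (addi J d) c.
  by move=> Ji; apply/seteqP; split; apply: sub.
move=> Ji; have Jdi := addi_ideal d Ji.
apply: addi_min; first exact: addi_ideal.
  apply: addi_min; [exact: addi_ideal| |exact: mem_addi].
  by move=> x Jx; apply: sub_addi; apply: sub_addi.
by apply: sub_addi; apply: mem_addi.
Qed.

Lemma foldl_addi_ideal J s : ideal J -> ideal (foldl addi J s).
Proof. by elim: s J => //= a s IH J Ji; apply: IH; apply: addi_ideal. Qed.

Lemma foldl_addi_sub J s : J `<=` foldl addi J s.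
Proof.
elim: s J => [J f //|a s IH J f Jf]; apply: (IH (addi J a)).
exact: sub_addi.
Qed.

Lemma foldl_addiC J s a : ideal J ->
  addi (foldl addi J s) a = foldl addi (addi J a) s.
Proof.
elim: s J => //= b s IH J Ji; rewrite IH; last exact: addi_ideal.
by rewrite addiC.
Qed.

Lemma quot_seq_ideal J s : ideal (quot_seq J s).
Proof. exact: ideal_gen_ideal. Qed.

Lemma quot_seq_nil J : ideal J -> quot_seq J [::] = J.
Proof.
move=> Ji; rewrite /quot_seq (_ : [set` [::]] = set0) ?setU0 ?ideal_gen_id //.
by apply/seteqP; split=> x; rewrite /= ?in_nil.
Qed.

Lemma sub_quot_seq J s : J `<=` quot_seq J s.
Proof. by move=> x Jx; apply: sub_gen_smallest; left. Qed.

Lemma mem_quot_seq J s a : a \in s -> quot_seq J s a.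
Proof. by move=> sa; apply: sub_gen_smallest; right. Qed.

Lemma quot_seq_min J K s : ideal K -> J `<=` K -> [set` s] `<=` K ->
  quot_seq J s `<=` K.
Proof. by move=> Ki JK sK; apply: ideal_gen_min => // x [/JK|/sK]. Qed.

Lemma quot_seq_cons J a s :
  ideal J -> quot_seq J (a :: s) = quot_seq (addi J a) s.
Proof.
move=> Ji; apply/seteqP; split; apply: quot_seq_min.
- exact: quot_seq_ideal.
- by move=> x Jx; apply: sub_quot_seq; apply: sub_addi.
- move=> x /=; rewrite inE => /predU1P[->|]; last exact: mem_quot_seq.
  by apply: sub_quot_seq; apply: mem_addi.
- exact: quot_seq_ideal.
- apply: addi_min; [exact: quot_seq_ideal|exact: sub_quot_seq|].
  by apply: mem_quot_seq; rewrite mem_head.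
- by move=> x /= sx; apply: mem_quot_seq; rewrite inE sx orbT.
Qed.

Lemma prime_of_set J : ideal J -> ~ J 1 ->
  (forall u v, J (u * v) -> J u \/ J v) ->
  exists Q : prime_idealr A, [set` Q] = J.
Proof.
move=> [J0 JD JM] J1 Jpr; pose S : A -> bool := fun x => `[< J x >].
have Sid : idealr_closed S.
  split; [exact/asboolP|exact/asboolP|].
  by move=> a u v /asboolP Ju /asboolP Jv; apply/asboolP/JD => //; apply: JM.
have Spr : prime_idealr_closed S.
  move=> u v /asboolP /Jpr [] Jx; apply/orP; [left|right]; exact/asboolP.
pose M1 := isIdealr.Build A S Sid.
pose M2 := isPrimeIdealrClosed.Build A S Spr.
pose Q : prime_idealr A := HB.pack S M1 M2.
by exists Q; apply/seteqP; split=> x /=; rewrite -[x \in Q]/(S x) => /asboolP.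
Qed.

(** Krull's separation lemma: an ideal maximal among those that contain K and miss the
    multiplicative set M is prime. *)
Lemma exists_prime_disjoint K (M : set A) : ideal K -> M 1 ->
  (forall a b, M a -> M b -> M (a * b)) -> (forall a, K a -> ~ M a) ->
  exists Q : prime_idealr A, K `<=` [set` Q] /\ forall a, a \in Q -> ~ M a.
Proof.
move=> Ki M1 MM KM.
(* Asking that the union of X and K be an ideal, rather than that X contain K, keeps the union of
   the empty chain in [P]. *)
pose P := [set X : set A | ideal (X `|` K) /\ forall a, (X `|` K) a -> ~ M a].
have [F FP Ftot|Y [[Yi YM] Ymax]] := @Zorn_bigcup A P.
  have mem2 a b : (\bigcup_(X in F) X `|` K) a ->
      (\bigcup_(X in F) X `|` K) b ->
      (exists2 X, F X & (X `|` K) a /\ (X `|` K) b) \/ K a /\ K b.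
    move=> [[X FX Xa]|Ka] [[Y FY Yb]|Kb]; last by right.
    - by left; have [XY|YX] := Ftot _ _ FX FY; [exists Y|exists X] => //;
        split; left => //; [exact: XY|exact: YX].
    - by left; exists X => //; split; [left|right].
    - by left; exists Y => //; split; [right|left].
  have up X a : F X -> (X `|` K) a -> (\bigcup_(X in F) X `|` K) a.
    by move=> FX [Xa|]; [left; exists X|right].
  split.
    case: (Ki) => K0 KD KN; split; first by right.
      move=> a b Fa /(mem2 _ _ Fa) [[X FX []]|[Ka Kb]]; last by right; apply: KD.
      by have [[_ XD _] _] := FP X FX => Xa Xb; apply/(up X)/XD.
    move=> a b Fb; have [[X FX [Xb _]]|[Kb _]] := mem2 _ _ Fb Fb.
      by have [[_ _ XM] _] := FP X FX; apply/(up X)/XM.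
    by right; apply: KN.
  move=> a Fa; have [[X FX [Xa _]]|[Ka _]] := mem2 _ _ Fa Fa; last exact: KM.
  by have [_ XM] := FP X FX; apply: XM.
pose J := Y `|` K.
have out u : ~ J u -> exists2 a, M a & addi J u a.
  move=> nJu; apply: contrapT => nex.
  have e : addi J u `|` K = addi J u.
    by apply/setUidPl => x Kx; apply: sub_addi; right.
  apply: (Ymax (addi J u)); last first.
    split; rewrite e; first exact: addi_ideal.
    by move=> a Ja Ma; apply: nex; exists a.
  rewrite properEneq; split; last by move=> y Yy; apply: sub_addi; left.
  by apply/eqP => eY; apply: nJu; left; rewrite eY; apply: mem_addi.
have [//||u v Juv|Q QJ] := @prime_of_set J.
- by move=> /YM.
- apply: contrapT => /not_orP[/out[a Ma [k [c [Jk ea]]]]].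
  move=> /out[b Mb [l [d [Jl eb]]]].
  apply: (YM (a * b)); last exact: MM.
  case: Yi => _ JD JM; rewrite ea eb mulrDl !mulrDr.
  rewrite mulrACA [k * l]mulrC [k * (d * v)]mulrC.
  by apply: (JD); apply: (JD); apply: JM.
exists Q; rewrite QJ; split; first by right.
by move=> a Qa; apply: YM; rewrite -/J -QJ.
Qed.

(* An element of the multiplicative set [b^e * t, t \notin Q] that lies in [K]
   would put t, hence 1, into [K]; so some prime between [K] and [Q] avoids b. *)
Lemma prime_below_avoiding K (Q : prime_idealr A) b : ideal K ->
  K `<=` [set` Q] -> (forall c, K (b * c) -> K c) ->
  exists Q' : prime_idealr A,
    [/\ K `<=` [set` Q'], [set` Q'] `<=` [set` Q] & b \notin Q'].
Proof.
move=> Ki KQ bK.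
pose M := [set x | exists e t, t \notin Q /\ x = b ^+ e * t].
have [//|||a Ka [e [t [tQ ea]]]|Q' [KQ' Q'M]] := @exists_prime_disjoint K M.
- by exists 0, 1; rewrite idealr1 expr0 mulr1.
- move=> x y [e [t [tQ ->]]] [f [u [uQ ->]]]; exists (e + f)%N, (t * u).
  by rewrite prime_idealrM negb_or tQ uQ exprD mulrACA.
- have : K t; last by move/KQ => /=; rewrite (negPf tQ).
  elim: e => [|e IH] in a ea Ka *; first by rewrite -[t]mul1r -(expr0 b) -ea.
  by apply: (IH (b ^+ e * t)) => //; apply: bK; rewrite mulrA -exprS -ea.
exists Q'; split=> //.
  move=> x Q'x /=; apply: contrapT => /negP xQ; apply: (Q'M x Q'x).
  by exists 0, x; rewrite expr0 mul1r.
apply/negP => /Q'M; apply; exists 1, 1; rewrite idealr1 expr1 mulr1; split=> //.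
Qed.

(** The chain is built downwards from Q. A prime over [K i.+1] contains [b i]; since [b i] is a
    nonzerodivisor modulo [K i], some prime over [K i] below it avoids [b i], which makes the
    inclusion strict. *)
Lemma prime_chain_of_nzd (K : nat -> set A) (b : nat -> A) n
    (Q : prime_idealr A) :
  (forall i, ideal (K i)) -> (forall i, i < n -> K i `<=` K i.+1)%N ->
  (forall i, (i < n)%N -> K i.+1 (b i)) ->
  (forall i, (i < n)%N -> forall c, K i (b i * c) -> K i c) ->
  K n `<=` [set` Q] ->
  exists c : nat -> prime_idealr A,
    [/\ c n = Q, forall i, (i <= n)%N -> K i `<=` [set` c i] &
        forall i, (i < n)%N -> [set` c i] `<` [set` c i.+1]].
Proof.
elim: n Q => [|n IH] Q Ki Kmon Kb Kreg KQ.
  exists (fun=> Q); split=> // i; rewrite leqn0 => /eqP-> //.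
have [|//||Q' [KQ' Q'Q bQ']] := @prime_below_avoiding (K n) Q (b n).
- exact: Ki.
- exact: subset_trans (Kmon _ _) KQ.
- exact: Kreg.
have [//|||||c [cn cK cmon]] := IH Q'.
- by move=> i /ltnW; apply: Kmon.
- by move=> i /ltnW; apply: Kb.
- by move=> i /ltnW; apply: Kreg.
- by [].
exists (fun i => if (i <= n)%N then c i else Q); split.
- by rewrite ltnn.
- move=> i; rewrite leq_eqVlt => /predU1P[->|]; first by rewrite ltnn.
  by rewrite ltnS => le_in; rewrite le_in; apply: cK.
- move=> i; rewrite ltnS leq_eqVlt => /predU1P[->|lt_in].
    rewrite eqxx ltnn cn properEneq; split=> //; apply/eqP => eQ.
    have : [set` Q] (b n) by apply/KQ/Kb.
    by rewrite -eQ /= (negPf bQ').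
  by rewrite lt_in orbT; apply: cmon.
Qed.

(** The inequality depth <= dim. Each s_i is a nonzerodivisor modulo the ideal of the preceding
    elements and lies in the next ideal, so a chain of primes can be threaded through these
    ideals. *)
Lemma dim_ge_regular_seq J s : ideal J -> regular_seq J s ->
  dim_ge J (size s).
Proof.
move=> Ji [sreg s1].
have [|||a Ka Ma|Q [KQ _]] :=
    @exists_prime_disjoint (quot_seq J s) [set 1].
- exact: quot_seq_ideal.
- by [].
- by move=> a b /= -> ->; rewrite mulr1.
- by apply: s1; rewrite -[1]Ma.
have [|i lt_is|i lt_is|||c [_ cK cmon]] := @prime_chain_of_nzd
    (fun i => quot_seq J (take i s)) (fun i => s`_i) (size s) Q.
- by move=> i; apply: quot_seq_ideal.
- apply: quot_seq_min; [exact: quot_seq_ideal|exact: sub_quot_seq|].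
  move=> x /= sx; apply: mem_quot_seq.
  by rewrite (take_nth 0) // mem_rcons inE sx orbT.
- by apply: mem_quot_seq; rewrite (take_nth 0) // mem_rcons mem_head.
- exact: sreg.
- by rewrite take_size.
exists c; split=> // i le_is.
by apply: subset_trans (cK i le_is); apply: sub_quot_seq.
Qed.

Lemma dim_ge_depth_ge (m J : set A) n :
  ideal J -> depth_ge m J n -> dim_ge J n.
Proof. by move=> Ji [s [<- _ /(dim_ge_regular_seq Ji)]]. Qed.

End IdealTheory.

Arguments addi {A} J a.

(** * Regular sequences and localization *)

Section LocallyRegular.
Variables (A : comNzRingType) (P : prime_idealr A).
Implicit Types (J K : set A) (a b : A) (s : seq A).
Local Open Scope ring_scope.
Local Open Scope classical_set_scope.

(* [a] is a nonzerodivisor on (A/K)_P. *)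
Definition loc_nzd K a : Prop :=
  forall b, K (a * b) -> exists2 t, t \notin P & K (t * b).

(** Stated with ideals of A, so that the inductions avoid fractions. Any sequence qualifies when the
    localized quotient is zero, which several base cases exploit; [regular_seq_loc] recovers
    properness from J and s lying in P. *)
Fixpoint loc_regular K s : Prop :=
  if s is a :: s' then loc_nzd K a /\ loc_regular (addi K a) s' else True.

Lemma notin_primeM a b : a \notin P -> b \notin P -> a * b \notin P.
Proof. by move=> aP bP; rewrite prime_idealrM negb_or aP. Qed.

Lemma notin_primeX a e : a \notin P -> a ^+ e \notin P.
Proof.
move=> aP; elim: e => [|e IH]; first by rewrite expr0 idealr1.
by rewrite exprS notin_primeM.
Qed.

Lemma loc_regular_unit K s t : ideal K -> K t -> t \notin P -> loc_regular K s.
Proof.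
elim: s K => //= a s IH K Ki Kt tP; split; last first.
  by apply: IH => //; [exact: addi_ideal|exact: sub_addi].
by move=> b _; exists t => //; case: Ki => _ _ KM; rewrite mulrC; apply: KM.
Qed.

Lemma loc_regular_cat K s1 s2 : loc_regular K s1 ->
  loc_regular (foldl addi K s1) s2 -> loc_regular K (s1 ++ s2).
Proof.
by elim: s1 K => //= a s IH K [aK sK] s2K; split=> //; apply: IH.
Qed.

Lemma loc_regular_take K s n : loc_regular K s -> loc_regular K (take n s).
Proof.
by elim: s K n => [|a s IH] K [|n] //= [aK sK]; split=> //; apply: IH.
Qed.

(* The hypotheses say that x induces an exact sequence
   0 -> A/K' -> A/K -> A/K'' -> 0 after localization at P. *)
Lemma loc_regular_extension K K' K'' x s :
    ideal K -> ideal K' -> ideal K'' ->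
    (forall b, K' b -> K (x * b)) ->
    (forall b, K (x * b) -> exists2 t, t \notin P & K' (t * b)) ->
    K'' = addi K x ->
  loc_regular K' s -> loc_regular K'' s -> loc_regular K s.
Proof.
elim: s K K' K'' => //= a s IH K K' K'' Ki Ki' Ki'' K'K KK' eK''.
move=> [aK' sK'] [aK'' sK'']; have [K0 KD KM] := Ki; have [_ KD' KM'] := Ki'.
split=> [b Kab|].
  have [|t tP] := aK'' b; first by rewrite eK''; apply: sub_addi.
  rewrite eK'' => -[j [c [Kj etb]]].
  have [|u uP K'uac] := KK' (a * c).
    rewrite (_ : x * (a * c) = t * (a * b) - a * j); last first.
      by rewrite [t * _]mulrCA etb; ring.
    by apply: idealB => //; apply: KM.
  have [|v vP K'vuc] := aK' (u * c); first by rewrite mulrCA.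
  exists (v * (u * t)); first by rewrite !notin_primeM.
  rewrite -!mulrA etb !mulrDr; apply: KD; first by do 2!apply: (KM).
  by rewrite mulrA mulrA mulrC; apply: K'K; rewrite -mulrA.
apply: (IH _ (addi K' a) (addi K'' a)) => //; try exact: addi_ideal.
- move=> _ [k [c [/K'K Kk ->]]]; exists (x * k), (x * c); split=> //.
  by rewrite mulrDr mulrA.
- move=> b [j [c [Kj exb]]].
  have [|t tP] := aK'' c.
    rewrite eK''; exists (- j), b; split.
      by rewrite -sub0r; apply: idealB.
    by rewrite [b * x]mulrC exb; ring.
  rewrite eK'' => -[k [d [Kk etc]]].
  have [|u uP K'u] := KK' (t * b - a * d).
    have -> : x * (t * b - a * d) = t * j + a * k; last first.
      by apply: (KD); apply: (KM).
    by rewrite mulrBr mulrCA exb mulrDr mulrA etc; ring.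
  exists (u * t); first exact: notin_primeM.
  exists (u * (t * b - a * d)), (u * d); split=> //.
  by rewrite -mulrA -mulrDr [d * a]mulrC subrK mulrA.
- by rewrite eK'' addiC.
Qed.

End LocallyRegular.

Section LocalizationTheory.
Variables (R : idomainType) (P : prime_idealr R).
Local Open Scope ring_scope.
Local Open Scope classical_set_scope.
Local Notation RP := (localization P).
Local Notation "x %:F" := (tofrac x) : ring_scope.
Implicit Types (J K : set R) (a b t : R) (z : RP).

Lemma loc_val_inj : injective (@loc_val R P).
Proof. exact: val_inj. Qed.

Lemma to_loc1 : to_loc P 1 = 1.
Proof. by apply: loc_val_inj; rewrite /= tofrac1. Qed.

Lemma to_loc0 : to_loc P 0 = 0.
Proof. by apply: loc_val_inj; rewrite /= tofrac0. Qed.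

Lemma to_locM a b : to_loc P (a * b) = to_loc P a * to_loc P b.
Proof. by apply: loc_val_inj; rewrite /= tofracM. Qed.

Lemma to_locD a b : to_loc P (a + b) = to_loc P a + to_loc P b.
Proof. by apply: loc_val_inj; rewrite /= tofracD. Qed.

Lemma to_loc_inj : injective (to_loc P).
Proof. by move=> a b /(congr1 (@loc_val R P)) /= /eqP; rewrite tofrac_eq => /eqP. Qed.

Lemma locP z : exists a t, t \notin P /\ to_loc P t * z = to_loc P a.
Proof.
have /asboolP[a [t [tP ez]]] := loc_valP z.
exists a, t; split=> //; apply: loc_val_inj; rewrite /= ez mulrC divfK //.
exact: local_denom_neq0 tP.
Qed.

Lemma to_loc_unit t : t \notin P -> exists u, u * to_loc P t = 1.
Proof.
move=> tP; have uP : (1%:F / t%:F) \in local_fracs P.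
  by apply/asboolP; exists 1, t.
exists (Localization uP); apply: loc_val_inj => /=.
by rewrite tofrac1 mul1r mulVf // (local_denom_neq0 tP).
Qed.

Lemma mem_ideal_loc J z : ideal J ->
  ideal_loc P J z <-> exists a t, [/\ t \notin P, J a & to_loc P t * z = to_loc P a].
Proof.
move=> [J0 JD JM]; split=> [|[a [t [tP Ja eza]]]]; last first.
  have [u ut] := to_loc_unit tP; rewrite -[z]mul1r -ut -mulrA eza.
  case: (ideal_gen_ideal (to_loc P @` J)) => _ _ JM'; apply: JM'.
  by apply: sub_gen_smallest; exists a.
pose L := [set z : RP |
  exists a t, [/\ t \notin P, J a & to_loc P t * z = to_loc P a]].
suff: ideal_loc P J `<=` L by apply.
apply: ideal_gen_min => [|_ [a Ja <-]]; last first.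
  by exists a, 1; rewrite idealr1 to_loc1 mul1r.
split=> [|z1 z2 [a [t [tP Ja ez1]]] [b [u [uP Jb ez2]]]|z1 z2].
- by exists 0, 1; rewrite idealr1 mulr0 to_loc0.
- exists (u * a + t * b), (t * u); split; first exact: notin_primeM.
    by apply: (JD); apply: (JM).
  by rewrite to_locD !to_locM -ez1 -ez2 mulrDr mulrCA !mulrA.
- move=> [a [t [tP Ja ez]]]; have [b [u [uP ezb]]] := locP z1.
  exists (b * a), (u * t); split; [exact: notin_primeM|exact: (JM)|].
  by rewrite !to_locM mulrACA ezb ez.
Qed.

Lemma to_loc_mem_ideal_loc J a : ideal J ->
  ideal_loc P J (to_loc P a) <-> exists2 t, t \notin P & J (t * a).
Proof.
move=> Ji; rewrite mem_ideal_loc //; split=> [[b [t [tP Jb]]]|[t tP Jta]].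
  by rewrite -to_locM => /to_loc_inj eb; exists t; rewrite ?eb.
by exists (t * a), t; rewrite to_locM.
Qed.

Lemma ideal_loc_ideal J : ideal (ideal_loc P J).
Proof. exact: ideal_gen_ideal. Qed.

Lemma sub_ideal_loc J a : J a -> ideal_loc P J (to_loc P a).
Proof. by move=> Ja; apply: sub_gen_smallest; exists a. Qed.

Lemma ideal_loc_sub J K : J `<=` K -> ideal_loc P J `<=` ideal_loc P K.
Proof.
move=> JK; apply: ideal_gen_min; first exact: ideal_loc_ideal.
by move=> _ [a /JK Ka <-]; apply: sub_ideal_loc.
Qed.

Lemma ideal_loc_addi J a : ideal J ->
  addi (ideal_loc P J) (to_loc P a) = ideal_loc P (addi J a).
Proof.
move=> Ji; apply/seteqP; split.
  apply: addi_min; first exact: ideal_loc_ideal.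
    by apply: ideal_loc_sub; apply: sub_addi.
  by apply: sub_ideal_loc; apply: mem_addi.
apply: ideal_gen_min; first by apply: addi_ideal; exact: ideal_loc_ideal.
move=> _ [_ [k [c [Jk ->]]] <-]; exists (to_loc P k), (to_loc P c).
by split; [exact: sub_ideal_loc|rewrite to_locD to_locM].
Qed.

Lemma max_loc_proper : ~ max_loc P 1.
Proof.
rewrite /max_loc -to_loc1 => /to_loc_mem_ideal_loc[|t tP]; first exact: prime_ideal.
by rewrite mulr1 /= (negPf tP).
Qed.

Lemma max_loc_or_unit z : max_loc P z \/ exists u, u * z = 1.
Proof.
have [a [t [tP ez]]] := locP z; case: (boolP (a \in P)) => aP; [left|right].
  by apply/mem_ideal_loc; [exact: prime_ideal|exists a, t].
have [u ua] := to_loc_unit aP; exists (u * to_loc P t).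
by rewrite -mulrA ez.
Qed.

Lemma loc_nzd_nzd K a z : ideal K -> loc_nzd P K a ->
  ideal_loc P K (to_loc P a * z) -> ideal_loc P K z.
Proof.
move=> Ki aK; have [_ _ KM] := Ki; have [b [t [tP ez]]] := locP z.
move=> /mem_ideal_loc[//|c [u [uP Kc ec]]].
have [|v vP Kv] := aK (u * b).
  suff -> : a * (u * b) = t * c by apply: KM.
  by apply: to_loc_inj; rewrite !to_locM -ec -ez; ring.
apply/mem_ideal_loc => //; exists (v * (u * b)), (v * (u * t)).
by split; [rewrite !notin_primeM|exact: Kv|rewrite !to_locM -!mulrA ez].
Qed.

Lemma regular_seq_loc J s : ideal J -> J `<=` [set` P] -> {subset s <= P} ->
  loc_regular P J s ->
  regular_seq (ideal_loc P J) [seq to_loc P a | a <- s].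
Proof.
move=> Ji JP sP sreg; split.
  elim: s J Ji sreg {JP sP} => //= a s IH J Ji [aJ sJ] [_|i].
    rewrite take0 quot_seq_nil; last exact: ideal_loc_ideal.
    by move=> z; apply: loc_nzd_nzd.
  rewrite ltnS => lt_is z /=; rewrite quot_seq_cons; last exact: ideal_loc_ideal.
  by rewrite ideal_loc_addi //; apply: IH => //; exact: addi_ideal.
suff sub: quot_seq (ideal_loc P J) [seq to_loc P a | a <- s] `<=` max_loc P.
  by move=> /sub; apply: max_loc_proper.
apply: quot_seq_min; [exact: ideal_loc_ideal|exact: ideal_loc_sub|].
by move=> _ /mapP[a sa ->]; apply: sub_ideal_loc; apply: sP.
Qed.

Lemma depth_ge_loc J s n : ideal J -> J `<=` [set` P] -> {subset s <= P} ->
  loc_regular P J s -> (n <= size s)%N ->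
  depth_ge (max_loc P) (ideal_loc P J) n.
Proof.
move=> Ji JP sP sreg le_ns; exists [seq to_loc P a | a <- take n s]; split.
- by rewrite size_map size_takel.
- move=> _ /mapP[a sa ->]; apply: sub_ideal_loc; apply: sP; exact: mem_take sa.
- apply: regular_seq_loc => //; first by move=> a /mem_take; apply: sP.
  exact: loc_regular_take.
Qed.

Lemma contract_prime (c : prime_idealr RP) : exists Q : prime_idealr R,
  [/\ [set` Q] `<=` [set` P] & forall a, (a \in Q) = (to_loc P a \in c)].
Proof.
have [|||Q eQ] := @prime_of_set _ [set a | to_loc P a \in c].
- split=> [|a b|a b] /=; first by rewrite to_loc0 rpred0.
    by rewrite to_locD; apply: rpredD.
  by rewrite to_locM; apply: idealMr.
- by rewrite /= to_loc1 idealr1.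
- by move=> a b /=; rewrite to_locM prime_idealrM => /orP.
have memQ a : (a \in Q) = (to_loc P a \in c).
  have [QE EQ] : [set` Q] a <-> to_loc P a \in c by rewrite eQ.
  by apply/idP/idP.
exists Q; split=> // a /=; rewrite memQ => ac; apply: contraT => aP.
have [u ua] := to_loc_unit aP; have := idealMr u ac.
by rewrite ua idealr1.
Qed.

Lemma extend_prime (Q : prime_idealr R) : [set` Q] `<=` [set` P] ->
  exists c : prime_idealr RP, forall a, (to_loc P a \in c) = (a \in Q).
Proof.
move=> QP; have Qi := prime_ideal Q.
have memL a : ideal_loc P [set` Q] (to_loc P a) <-> a \in Q.
  rewrite to_loc_mem_ideal_loc //; split=> [[t tP /=]|aQ].
    rewrite prime_idealrM => /orP[/QP|//]; by rewrite /= (negPf tP).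
  by exists 1; rewrite ?idealr1 /= ?mul1r.
have [|||c ec] := @prime_of_set _ (ideal_loc P [set` Q]).
- exact: ideal_loc_ideal.
- by rewrite -to_loc1 memL idealr1.
- move=> z1 z2; have [a [t [tP ea]]] := locP z1.
  have [b [u [uP eb]]] := locP z2; have [_ _ LM] := ideal_loc_ideal [set` Q].
  have unl s w c : s \notin P -> to_loc P s * w = to_loc P c -> c \in Q ->
      ideal_loc P [set` Q] w.
    by move=> sP ew cQ; apply/mem_ideal_loc => //; exists c, s.
  move=> /(LM (to_loc P (t * u))).
  rewrite to_locM mulrACA ea eb -to_locM memL prime_idealrM => /orP[aQ|bQ].
    by left; apply: unl ea aQ.
  by right; apply: unl eb bQ.
exists c => a; apply/idP/idP => [ac|/memL]; last by rewrite -ec.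
by apply/memL; rewrite -ec.
Qed.

Lemma dim_ge_loc J n : ideal J ->
  dim_ge (ideal_loc P J) n <->
  exists c : nat -> prime_idealr R,
    [/\ forall i, (i <= n)%N -> J `<=` [set` c i] /\ [set` c i] `<=` [set` P] &
        forall i, (i < n)%N -> [set` c i] `<` [set` c i.+1]].
Proof.
move=> Ji; split=> [[c [Jc cmon]]|[c [Jc cmon]]].
  have /choice[d Hd] : forall i, exists Q : prime_idealr R,
      [/\ [set` Q] `<=` [set` P] & forall a, (a \in Q) = (to_loc P a \in c i)].
    by move=> i; apply: contract_prime.
  exists d; split=> [i le_in|i lt_in]; have [dP dE] := Hd i.
    split=> // a Ja /=; rewrite dE; apply: (Jc i le_in).
    exact: sub_ideal_loc.
  have [_ dE'] := Hd i.+1; have := cmon i lt_in.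
  rewrite !properEneq => -[neq sub]; split; last first.
    by move=> a /=; rewrite dE dE'; apply: sub.
  apply: contra_neq neq => ed; apply/seteqP; split=> // z /= cz.
  have [a [t [tP ez]]] := locP z.
  have: to_loc P a \in c i.+1 by rewrite -ez idealMr.
  rewrite -dE' => aQ; have : [set` d i] a by rewrite ed.
  rewrite /= dE -ez prime_idealrM => /orP[|//].
  by rewrite -dE => /dP; rewrite /= (negPf tP).
have /choice[d Hd] : forall i, exists Q : prime_idealr RP, (i <= n)%N ->
    forall a, (to_loc P a \in Q) = (a \in c i).
  move=> i; case: (leqP i n) => [/Jc[_ /extend_prime[Q QE]]|]; first by exists Q.
  by move=> lt_ni; have [Q _] := extend_prime (@subset_refl _ [set` P]); exists Q.
exists d; split=> [i le_in|i lt_in].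
  apply: ideal_gen_min; first exact: prime_ideal.
  by move=> _ [a Ja <-] /=; rewrite Hd //; apply: (proj1 (Jc i le_in)).
have dE := Hd i (ltnW lt_in); have dE' := Hd i.+1 lt_in.
have := cmon i lt_in; rewrite !properEneq => -[neq sub]; split.
  apply: contra_neq neq => ed; apply/seteqP; split=> // a /= ca.
  have : [set` d i.+1] (to_loc P a) by rewrite /= dE'.
  by rewrite -ed /= dE.
move=> z /= dz; have [a [t [tP ez]]] := locP z.
have : to_loc P a \in d i by rewrite -ez idealMr.
rewrite dE => /sub /=; rewrite -dE' -ez prime_idealrM dE' => /orP[|//].
by move=> /(proj2 (Jc i.+1 lt_in)) /=; rewrite (negPf tP).
Qed.

End LocalizationTheory.

From mathcomp Require Import fintype finset.

(** * Stanley-Reisner ideals *)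

Section StanleyReisner.
Variables (k : fieldType) (V : finType).
Local Open Scope ring_scope.
Local Notation S := {mpoly k[#|V|]}.
Local Notation X := (@vertex_var k V).
Local Notation er := (@enum_rank V).
Implicit Types (D : {set {set V}}) (F T : {set V}) (f g : S).

Definition msupport (m : 'X_{1..#|V|}) : {set V} := [set v | m (er v) != 0%N].

Lemma msupportD m1 m2 : msupport (m1 + m2) = msupport m1 :|: msupport m2.
Proof. by apply/setP=> v; rewrite !inE mnmDE addn_eq0 negb_and. Qed.

Lemma msupportU v : msupport U_(er v) = [set v].
Proof.
apply/setP=> u; rewrite !inE mnm1E (inj_eq enum_rank_inj) [v == u]eq_sym.
by case: (u == v).
Qed.

Lemma msupportB m1 m2 : msupport (m1 - m2) \subset msupport m1.
Proof.
by apply/subsetP=> v; rewrite !inE mnmBE -!lt0n subn_gt0; apply: leq_ltn_trans.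
Qed.

Lemma msupport0 : msupport 0%MM = set0.
Proof. by apply/setP=> v; rewrite !inE mnm0E. Qed.

Lemma lemU_msupport v m : (U_(er v) <= m)%MM = (v \in msupport m).
Proof.
rewrite inE; apply/mnm_lepP/idP => [/(_ (er v))|mv i]; first by rewrite mnm1E eqxx lt0n.
by rewrite mnm1E; case: eqP => // <-; rewrite lt0n.
Qed.

Lemma mcoeffMX_sub f m m0 :
  (f * 'X_[m])@_m0 = if (m <= m0)%MM then f@_(m0 - m) else 0.
Proof.
case: ifP => le_m; first by rewrite -{1}(submK le_m) addmC mcoeffMX.
apply: contraFeq le_m; rewrite -mcoeff_msupp (perm_mem (msuppMX _ _)).
by case/mapP=> m' _ ->; rewrite lem_addr.
Qed.

Lemma mcoeff_XvM v f m :
  (X v * f)@_m = if v \in msupport m then f@_(m - U_(er v)) else 0.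
Proof.
by rewrite mulrC mcoeffMX_sub lemU_msupport.
Qed.

(** Encoded by vanishing coefficients instead of generators, so that membership is decided monomial
    by monomial. For empty D this is the unit ideal. *)
Definition stanley_reisner D : set S :=
  [set f | forall m, msupport m \in D -> f@_m = 0]%classic.

Definition downclosed D : Prop :=
  forall A B : {set V}, A \subset B -> B \in D -> A \in D.

Lemma stanley_reisner_ideal D : downclosed D -> ideal (stanley_reisner D).
Proof.
move=> Dd; split=> [m _|f g If Ig m Dm|f g Ig m Dm].
- by rewrite mcoeff0.
- by rewrite mcoeffD If ?Ig ?addr0.
- rewrite [f]mpolyE mulr_suml raddf_sum big1 // => m' _ /=.
  rewrite -scalerAl mcoeffZ mulrC mulrC [X in _ * X](_ : _ = 0) ?mulr0 //.
  rewrite mulrC mcoeffMX_sub; case: ifP => // le_m.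
  by apply: Ig; apply: Dd Dm; apply: msupportB.
Qed.

Definition mfilter (p : pred 'X_{1..#|V|}) f : S :=
  \sum_(m <- msupp f | p m) f@_m *: 'X_[m].

Lemma mcoeff_mfilter p f m : (mfilter p f)@_m = if p m then f@_m else 0.
Proof.
rewrite /mfilter raddf_sum /=; have [fm|fm] := boolP (m \in msupp f).
  case: ifP => pm; last first.
    rewrite big1 // => m' pm'; rewrite mcoeffZ mcoeffX.
    by case: eqP pm' => [->|]; rewrite ?pm ?mulr0.
  rewrite big_mkcond (bigD1_seq m) ?msupp_uniq //= pm mcoeffZ mcoeffX eqxx mulr1.
  rewrite big1 ?addr0 // => m' /negPf ne.
  by rewrite mcoeffZ mcoeffX ne mulr0 if_same.
rewrite [RHS](_ : _ = 0); last by rewrite (memN_msupp_eq0 fm); case: ifP.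
rewrite big_seq_cond big1 // => m' /andP[fm' _]; rewrite mcoeffZ mcoeffX.
by case: eqP fm' => [->|]; rewrite ?(negPf fm) ?mulr0.
Qed.

Lemma mfilter_split p f : f = mfilter p f + mfilter (predC p) f.
Proof.
by apply/mpolyP=> m; rewrite mcoeffD !mcoeff_mfilter /=; case: (p m);
  rewrite ?addr0 ?add0r.
Qed.

(** In contrast to [link], F may contain x: this is the cone with apex x over the link, and its
    ideal is the colon ideal of SR(D) by the variable of x. *)
Definition star D x : {set {set V}} := [set F : {set V} | x |: F \in D].

Lemma star_downclosed D x : downclosed D -> downclosed (star D x).
Proof. by move=> Dd A B AB; rewrite !inE; apply: Dd; apply: setUS. Qed.

Lemma del_downclosed D x : downclosed D -> downclosed (del D x).
Proof.
move=> Dd A B AB; rewrite !inE => /andP[DB xB]; rewrite (Dd _ _ AB DB).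
by apply: contra xB; apply: (subsetP AB).
Qed.

Lemma powerset_downclosed F : downclosed (powerset F).
Proof. by move=> A B AB; rewrite !powersetE; apply: subset_trans. Qed.

Lemma stanley_reisner_colon D x f :
  stanley_reisner D (X x * f) <-> stanley_reisner (star D x) f.
Proof.
split=> If m; rewrite ?inE => Dm; last first.
  rewrite mcoeff_XvM; case: ifP => // xm; apply: If; rewrite inE.
  suff -> : x |: msupport (m - U_(er x)) = msupport m by [].
  by rewrite setUC -msupportU -msupportD submK // lemU_msupport.
have := If (U_(er x) + m)%MM; rewrite msupportD msupportU => /(_ Dm).
by rewrite mcoeff_XvM msupportD msupportU setU11 addmC addmK.
Qed.

Lemma Xv_divides x f : (forall m, f@_m != 0 -> x \in msupport m) ->
  exists g, f = X x * g.
Proof.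
move=> fx; exists (\sum_(m <- msupp f) f@_m *: 'X_[m - U_(er x)]).
rewrite {1}[f]mpolyE mulr_sumr; apply: eq_big_seq => m; rewrite mcoeff_msupp.
by move=> /fx xm; rewrite -scalerAr -mpolyXD addmC submK // lemU_msupport.
Qed.

Lemma stanley_reisner_del D x : downclosed D ->
  addi (stanley_reisner D) (X x) = stanley_reisner (del D x).
Proof.
move=> Dd; apply/seteqP; split.
  apply: addi_min.
  - by apply/stanley_reisner_ideal/del_downclosed.
  - by move=> f If m; rewrite inE => /andP[/If].
  move=> m; rewrite inE => /andP[_ xm]; rewrite -[X x]mulr1 mcoeff_XvM.
  by rewrite (negPf xm).
move=> f If; rewrite [f](mfilter_split (fun m => x \notin msupport m)).
have [g ->] : exists g, mfilter (predC (fun m => x \notin msupport m)) f = X x * g.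
  apply: Xv_divides => m; rewrite mcoeff_mfilter /= negbK.
  by case: ifP => //; rewrite eqxx.
exists (mfilter (fun m => x \notin msupport m) f), g; split; last by rewrite mulrC.
move=> m Dm; rewrite mcoeff_mfilter; case: ifP => // xm.
by apply: If; rewrite inE Dm.
Qed.

Lemma Xv_mem_stanley_reisner D v : [set v] \notin D -> downclosed D ->
  stanley_reisner D (X v).
Proof.
move=> vD Dd m Dm; rewrite -[X v]mulr1 mcoeff_XvM; case: ifP => // vm.
by case/negP: vD; apply: Dd Dm; rewrite sub1set.
Qed.

(** A ring morphism into a domain that sends the variables outside F to 0. Its kernel is the ideal
    of the simplex F, which is therefore prime. *)
Definition kill (F : {set V}) (f : S) : S :=
  mmap (@mpolyC #|V| k) (fun i => if enum_val i \in F then 'X_i : S else 0) f.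

Lemma killX F m :
  kill F 'X_[m] = if msupport m \subset F then 'X_[m] else 0.
Proof.
rewrite /kill mmapX /mmap1; case: ifP => mF.
  rewrite mpolyXE_id; apply: eq_bigr => i _; case: ifP => // iF.
  case: (eqVneq (m i) 0%N) => [->|mi]; first by rewrite !expr0.
  by rewrite (subsetP mF) // inE enum_valK in iF.
move/negbT: mF => /subsetPn[v]; rewrite inE => mv vF.
rewrite (bigD1 (er v)) //= enum_rankK (negPf vF) expr0n (negPf mv) mul0r //.
Qed.

Lemma mcoeff_kill F f m :
  (kill F f)@_m = if msupport m \subset F then f@_m else 0.
Proof.
have -> : kill F f = \sum_(m <- msupp f) f@_m *: kill F 'X_[m].
  rewrite {1}[f]mpolyE /kill raddf_sum /=; apply: eq_bigr => m' _.
  by rewrite mmapZ mul_mpolyC.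
rewrite -(mcoeff_mfilter (fun m => msupport m \subset F)) /mfilter [in RHS]big_mkcond.
congr (mcoeff m _); apply: eq_bigr => m' _; rewrite killX.
by case: ifP; rewrite ?scaler0.
Qed.

Lemma stanley_reisner_kill F f :
  stanley_reisner (powerset F) f <-> kill F f = 0.
Proof.
split=> [If|f0 m]; last first.
  rewrite powersetE => mF; have := congr1 (mcoeff m) f0.
  by rewrite mcoeff_kill mF mcoeff0.
apply/mpolyP => m; rewrite mcoeff_kill mcoeff0; case: ifP => // mF.
by apply: If; rewrite powersetE.
Qed.

Lemma stanley_reisner_prime F : exists Q : prime_idealr S,
  [set` Q]%classic = stanley_reisner (powerset F).
Proof.
apply: prime_of_set.
- exact/stanley_reisner_ideal/powerset_downclosed.
- move=> /(_ 0%MM); rewrite msupport0 powersetE sub0set mcoeff1 eqxx.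
  by move=> /(_ isT)/eqP; rewrite oner_eq0.
- move=> u v /stanley_reisner_kill; rewrite /kill rmorphM => /eqP.
  by rewrite mulf_eq0 => /orP[]/eqP /stanley_reisner_kill; [left|right].
Qed.

Lemma stanley_reisner_sub D D' : D' \subset D ->
  (stanley_reisner D `<=` stanley_reisner D')%classic.
Proof. by move=> /subsetP DD' f If m /DD'; apply: If. Qed.

(* f as a univariate polynomial in X_y; its coefficients still live in the
   whole ring but do not involve X_y. *)
Definition univ (y : V) (f : S) : {poly S} :=
  mmap (polyC \o @mpolyC #|V| k)
       (fun i => if i == er y then 'X : {poly S} else ('X_i)%:P) f.

Definition polynomial_in T f : Prop := forall m, f@_m != 0 -> msupport m \subset T.

Definition mdrop (y : V) (m : 'X_{1..#|V|}) : 'X_{1..#|V|} :=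
  [multinom if i == er y then 0%N else m i | i < #|V|].

Lemma univM y : {morph univ y : f g / f * g}.
Proof. by move=> f g; rewrite /univ rmorphM. Qed.

Lemma univD y : {morph univ y : f g / f + g}.
Proof. by move=> f g; rewrite /univ rmorphD. Qed.

Lemma univX y m : univ y 'X_[m] = ('X_[mdrop y m])%:P * 'X^(m (er y)).
Proof.
rewrite /univ mmapX /mmap1 (bigD1 (er y)) //= eqxx mulrC; congr (_ * _).
rewrite [X in _ = X%:P]mpolyXE_id [in RHS](bigD1 (er y)) //= mnmE eqxx.
rewrite expr0 mul1r rmorph_prod /=.
by apply: eq_bigr => i /negPf ni; rewrite mnmE ni rmorphXn.
Qed.

Lemma univZX y c m :
  univ y (c *: 'X_[m]) = (c *: 'X_[mdrop y m])%:P * 'X^(m (er y)).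
Proof.
rewrite /univ mmapZ -/(univ y _) univX /= -mul_mpolyC rmorphM /=.
by rewrite mulrA.
Qed.

Lemma horner_univ y f : (univ y f).[X y] = f.
Proof.
rewrite {1}[f]mpolyE /univ raddf_sum /= -/(univ y _) horner_sum.
rewrite [RHS]mpolyE; apply: eq_bigr => m _; rewrite -/(univ y _) univZX.
rewrite hornerM hornerC hornerXn -scalerAl; congr (_ *: _).
rewrite /vertex_var mpolyXn -mpolyXD; congr 'X_[_]; apply/mnmP => i.
rewrite mnmDE mulmnE mnm1E mnmE [er y == i]eq_sym.
by case: eqP => [->|_]; rewrite ?mul1n ?mul0n ?addn0.
Qed.

Lemma mcoeff_univ y f j m :
  ((univ y f)`_j)@_m = if m (er y) == 0%N then f@_(m + U_(er y) *+ j) else 0.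
Proof.
have -> : univ y f = \sum_(m <- msupp f) univ y (f@_m *: 'X_[m]).
  by rewrite {1}[f]mpolyE /univ raddf_sum.
rewrite coef_sum raddf_sum /=.
have -> : (if m (er y) == 0%N then f@_(m + U_(er y) *+ j) else 0) =
    \sum_(m' <- msupp f)
      if m (er y) == 0%N then (f@_m' *: 'X_[m'])@_(m + U_(er y) *+ j) else 0.
  by case: ifP => _; [rewrite {1}[f]mpolyE raddf_sum|rewrite big1].
apply: eq_bigr => m' _; rewrite univZX coefCM coefXn mulr_natr mcoeffMn.
rewrite !mcoeffZ !mcoeffX.
transitivity (f@_m' * ((mdrop y m' == m) && (j == m' (er y)))%:R).
  by case: (j == _); rewrite ?mulr1n ?mulr0n ?andbT ?andbF ?mulr0.
transitivity (f@_m' * ((m (er y) == 0%N) && (m' == (m + U_(er y) *+ j)%MM))%:R);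
  last by case: ifP; rewrite ?mulr0.
congr (_ * (nat_of_bool _)%:R).
apply/andP/andP => [[/eqP <- /eqP ->]|[/eqP m0 /eqP ->]]; split; last 1 first.
- by rewrite mnmDE m0 mulmnE mnm1E eqxx mul1n.
- by rewrite mnmE eqxx.
- apply/eqP/mnmP => i; rewrite mnmDE mulmnE mnm1E mnmE [er y == i]eq_sym.
  by case: eqP => [->|_]; rewrite ?mul1n ?mul0n ?addn0.
- apply/eqP/mnmP => i; rewrite mnmE mnmDE mulmnE mnm1E [er y == i]eq_sym.
  by case: eqP => [->|_]; rewrite ?m0 // mul0n addn0.
Qed.

Lemma univ_neq0 y f : f != 0 -> univ y f != 0.
Proof. by apply: contra_neq => f0; rewrite -(horner_univ y f) f0 horner0. Qed.

Lemma univ_free T y f : polynomial_in T f -> y \notin T -> univ y f = f%:P.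
Proof.
move=> fT yT; apply/polyP => j; apply/mpolyP => m; rewrite mcoeff_univ coefC.
have fy m' : y \in msupport m' -> f@_m' = 0.
  by move=> ym'; apply: contraNeq yT => /fT/subsetP; apply.
case: j => [|j] /=.
  rewrite mulm0n addm0; case: eqP => // /eqP my.
  by rewrite fy // inE.
rewrite mcoeff0; case: ifP => // _; apply: fy; rewrite msupportD inE.
by rewrite [X in _ || X]inE mulmnE mnm1E eqxx orbT.
Qed.

Lemma polynomial_in_univ T y f j : polynomial_in (y |: T) f ->
  polynomial_in T (univ y f)`_j.
Proof.
move=> fT m; rewrite mcoeff_univ; case: ifP => [/eqP my /fT|]; last by rewrite eqxx.
rewrite msupportD subUset => /andP[/subsetP sub _]; apply/subsetP => v vm.
have /setU1P[ev|//] := sub v vm.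
by move: vm; rewrite ev inE my.
Qed.

Definition extended y (K : set S) : Prop := forall f, K f -> forall j, K (univ y f)`_j.

Lemma stanley_reisner_extended y F : y \in F ->
  extended y (stanley_reisner (powerset F)).
Proof.
move=> yF f If j m; rewrite powersetE => mF; rewrite mcoeff_univ.
case: ifP => // _; apply: If; rewrite powersetE msupportD subUset mF /=.
apply/subsetP => v; rewrite inE mulmnE mnm1E (inj_eq enum_rank_inj).
by have [<-|] := eqVneq y v.
Qed.

Lemma addi_extended y K a : ideal K -> extended y K -> univ y a = a%:P ->
  extended y (addi K a).
Proof.
move=> Ki Ky ya _ [f [c [Kf ->]]] j; rewrite univD univM ya coefD coefMC.
by exists (univ y f)`_j, (univ y c)`_j; split=> //; apply: Ky.
Qed.

(* [extended y K] says that K is extended from the polynomials without X_y, so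
   that the leading coefficients of [univ y b] can be stripped one at a time. *)
Lemma extended_loc_nzd (P : prime_idealr S) y K a : ideal K -> extended y K ->
  lead_coef (univ y a) \notin P -> loc_nzd P K a.
Proof.
move=> Ki Ky aP b Kab; have [K0 KD KM] := Ki.
have strip (p q : {poly S}) : lead_coef p \notin P -> (forall j, K (p * q)`_j) ->
    exists2 t, t \notin P & forall j, K (t *: q)`_j.
  move=> pP; have [n] := ubnP (size q); elim: n q => // n IH q lt_qn Kpq.
  have [->|q0] := eqVneq q 0.
    by exists 1; rewrite ?idealr1 // => j; rewrite scaler0 coef0.
  have p0 : p != 0.
    by apply: contraNneq pP => ->; rewrite lead_coef0 rpred0.
  set l := lead_coef p; set c := lead_coef q; set e := (size q).-1.
  have Klc : K (l * c).
    have := Kpq (size (p * q)).-1; rewrite -[_`_ _]/(lead_coef (p * q)).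
    by rewrite lead_coefM.
  (* The product l c is the leading coefficient of p q, so it lies in K. Subtracting l c X^e from l
     q cancels the leading term, and the product with p still has its coefficients in K. *)
  have [||t tP Kt] := IH (l *: q - (l * c) *: 'X^e).
  - have sq : (0 < size q)%N by rewrite size_poly_gt0.
    have : (size (l *: q - (l * c) *: 'X^e)%R <= e)%N.
      apply/leq_sizeP => j; rewrite leq_eqVlt coefB !coefZ coefXn.
      move=> /predU1P[<-|lt_ej]; first by rewrite eqxx mulr1 subrr.
      rewrite gtn_eqF // mulr0 subr0 nth_default ?mulr0 //.
      by move: lt_ej; rewrite /e; case: (size q) sq.
    move=> /leq_ltn_trans; apply.
    by rewrite -ltnS /e prednK.
  - move=> j; rewrite mulrBr -!scalerAr coefB !coefZ.
    by apply: idealB => //; [exact: KM|rewrite mulrC; apply: (KM)].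
  exists (t * l) => [|j]; first exact: notin_primeM.
  have := KD _ _ (Kt j) (KM (t * ('X^e)`_j) _ Klc).
  rewrite scalerBr coefB !coefZ !mulrA addrC.
  set u := t * l * q`_j => h; suff <- : t * ('X^e)`_j * l * c +
    (u - t * l * c * ('X^e)`_j) = u by [].
  ring.
have [|t tP Kt] := strip (univ y a) (univ y b) aP.
  by move=> j; rewrite -univM; apply: Ky.
exists t => //; rewrite -(horner_univ y b) horner_coef mulr_sumr.
apply: ideal_sum => // i _; rewrite mulrA mulrC; apply: (KM).
by have := Kt i; rewrite coefZ.
Qed.

Lemma univ_Xv y : univ y (X y) = 'X.
Proof.
rewrite /vertex_var univX mnm1E eqxx expr1 (_ : mdrop y _ = 0%MM).
  by rewrite mpolyX0 mul1r.
by apply/mnmP => i; rewrite mnmE mnm1E mnm0E [er y == i]eq_sym; case: eqP.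
Qed.

(** Multiplication by [X y] only shifts the coefficients of [univ y f], and those lie in K. *)
Lemma extended_Xv y K f : extended y K -> K (X y * f) -> ideal K -> K f.
Proof.
move=> Ky Kf [K0 KD KM]; rewrite -(horner_univ y f) horner_coef.
apply: ideal_sum => // i _; rewrite mulrC; apply: (KM).
by have := Ky _ Kf i.+1; rewrite univM univ_Xv mulrC coefMX.
Qed.

Definition Xset (A : {set V}) : S := \prod_(v in A) X v.

Lemma polynomial_in0 f : polynomial_in set0 f -> f = (f@_0)%:MP.
Proof.
move=> f0; apply/mpolyP => m; rewrite mcoeffC.
case: eqP => [->|m0]; first by rewrite mulr1.
rewrite mulr0; apply: contra_notP m0 => /eqP/f0; rewrite subset0 => /eqP ms.
apply/mnmP => i; rewrite mnm0E; apply/eqP; rewrite -[i]enum_valK.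
have : enum_val i \notin msupport m by rewrite ms inE.
by rewrite inE negbK.
Qed.

End StanleyReisner.

(** * A regular sequence for vertex decomposable complexes *)

Section Nice.
Variable V : finType.
Implicit Types (D L : {set {set V}}) (F : {set V}).

(* The Stanley-Reisner ring of D is an extension of that of [del D x] by a copy
   of that of the star of x; all facets have d vertices throughout. *)
Inductive nice : nat -> {set {set V}} -> Prop :=
| nice_simplex F : nice #|F| (powerset F)
| nice_glue d D x of [set x] \in D & nice d (star D x) & nice d (del D x) :
    nice d D.

(** Vertex decomposability speaks of the link while [nice_glue] asks for the star; the star is the
    cone over the link, and coning adds one vertex to every facet. *)
Lemma nice_cone d L x : nice d L -> (forall F, F \in L -> x \notin F) ->
  nice d.+1 [set F : {set V} | F :\ x \in L].
Proof.
move=> nL; elim: {d L}nL => [F|d L y yL _ IHs _ IHd] Lx.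
  have xF : x \notin F by apply: Lx; rewrite powersetE.
  rewrite (_ : [set _ | _] = powerset (x |: F)).
    by have := nice_simplex (x |: F); rewrite cardsU1 xF.
  by apply/setP=> A; rewrite !inE subDset.
have xy : x != y by have := Lx _ yL; rewrite inE.
apply: (@nice_glue _ _ y).
- rewrite inE (_ : [set y] :\ x = [set y]) //.
  by apply/setP=> z; rewrite !inE andbC; case: eqP => // ->; rewrite eq_sym xy.
- rewrite (_ : star _ y = [set F : {set V} | F :\ x \in star L y]).
    apply: IHs => F; rewrite inE => /Lx; rewrite !inE negb_or.
    by case/andP.
  apply/setP=> A; rewrite !inE (_ : (y |: A) :\ x = y |: (A :\ x)) //.
  by apply/setP=> z; rewrite !inE; case: (eqVneq z y) => [->|]; rewrite ?(eq_sym y) ?xy.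
- rewrite (_ : del _ y = [set F : {set V} | F :\ x \in del L y]).
    by apply: IHd => F; rewrite inE => /andP[/Lx].
  by apply/setP=> A; rewrite !inE eq_sym xy.
Qed.

Lemma facet_ext D A : A \in D -> exists2 F, facet D F & A \subset F.
Proof. by move=> /(@maxset_exists _ (fun B => B \in D)) [F]; exists F. Qed.

Lemma link_downclosed D x : downclosed D -> downclosed (link D x).
Proof.
move=> Dd A B AB; rewrite !inE => /andP[xB DB]; rewrite (Dd _ (x |: B)) ?setUS //.
by rewrite andbT; apply: contra xB; apply: (subsetP AB).
Qed.

(** Purity is inherited by both pieces: facets of the deletion are facets of D by shedding, and a
    facet of the link becomes a facet of D once x is added. So the link has facets of size d - 1,
    and the star has facets of size d again. *)
Lemma vertex_decomposable_nice D d : vertex_decomposable D -> downclosed D ->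
  D != set0 -> (forall F, facet D F -> #|F| = d) -> nice d D.
Proof.
move=> vdD; elim: {D}vdD d => [D F ->|D ->|D x xD _ IHl _ IHd sh] d Dd D0 Dp.
- suff <- : #|F| = d by apply: nice_simplex.
  apply: Dp; apply/maxsetP; rewrite powersetE; split=> // A.
  by rewrite powersetE => AF FA; apply/eqP; rewrite eqEsubset AF.
- by rewrite eqxx in D0.
have D00 : set0 \in D by apply: Dd xD; rewrite sub0set.
apply: (nice_glue xD); last first.
- apply: IHd => [|| F /sh/Dp //]; first exact: del_downclosed.
  by apply/set0Pn; exists set0; rewrite inE D00 inE.
case: d Dp => [Dp|d Dp].
  have [F /Dp/eqP] := facet_ext xD; rewrite cards_eq0 => /eqP->.
  by rewrite sub1set inE.
rewrite (_ : star D x = [set F : {set V} | F :\ x \in link D x]); last first.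
  apply/setP=> A; rewrite !inE eqxx /= (_ : x |: A :\ x = x |: A) //.
  by apply/setP=> z; rewrite !inE; case: eqP.
apply: nice_cone => [|F]; last by rewrite inE => /andP[].
apply: IHl; first exact: link_downclosed.
  by apply/set0Pn; exists set0; rewrite !inE setU0 xD.
move=> F /maxsetP[]; rewrite inE => /andP[xF xFD] Fmax.
suff /Dp : facet D (x |: F) by rewrite cardsU1 xF => -[].
apply/maxsetP; split=> // A AD xFA.
have xA : x \in A by apply: (subsetP xFA); rewrite setU11.
rewrite -(setD1K xA); congr (_ |: _); apply: Fmax; last first.
  by apply/subsetP => z zF; rewrite !inE (subsetP xFA) ?inE ?zF ?orbT // andbT;
    apply: contraNneq xF => <-.
by rewrite !inE eqxx /= setD1K.
Qed.

End Nice.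

(** * Parameters at an arbitrary prime of the polynomial ring *)

Section SystemOfParameters.
Variables (k : fieldType) (V : finType).
Local Open Scope ring_scope.
Local Notation S := {mpoly k[#|V|]}.
Local Notation X := (@vertex_var k V).
Local Notation SR := (@stanley_reisner k V).
Variable P : prime_idealr S.
Implicit Types (D : {set {set V}}) (F T B : {set V}) (f g : S).

Definition unit_vars : {set V} := [set v | X v \notin P].
Local Notation G := unit_vars.
Local Notation W := (~: unit_vars).

Definition independent_mod T : Prop :=
  forall f, polynomial_in T f -> f \in P -> f = 0.

Lemma lead_coef_univ_notin T y f : independent_mod T ->
  polynomial_in (y |: T) f -> f != 0 -> lead_coef (univ y f) \notin P.
Proof.
move=> iT fT f0; apply/negP => /iT lf.
have : lead_coef (univ y f) = 0 by apply/lf/polynomial_in_univ.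
by move/eqP; rewrite lead_coef_eq0; apply/negP/univ_neq0.
Qed.

Lemma independent_mod0 : independent_mod set0.
Proof.
move=> f /polynomial_in0 -> ; set c := (X in X%:MP) => cP.
apply/eqP; rewrite mpolyC_eq0; apply: contraTT cP => c0.
apply/negP => /(idealMr (c^-1)%:MP).
by rewrite -mpolyCM mulVf // mpolyC1 idealr1.
Qed.

(** T acts as a transcendence basis, chosen among the variables, of the residue field of P. The
    leading coefficient of a relation is a nonzero polynomial in T, hence outside P; this is what
    makes the relation a nonzerodivisor locally. *)
Lemma maximal_independent_mod : exists T, independent_mod T /\
  forall y, y \notin T -> exists g,
    [/\ polynomial_in (y |: T) g, g \in P & lead_coef (univ y g) \notin P].
Proof.
pose p T := `[< independent_mod T >].
have [|T /maxsetP[/asboolP iT Tmax] _] := @maxset_exists _ p set0.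
  exact/asboolP/independent_mod0.
exists T; split=> // y yT; apply: contrapT => nog.
have : p (y |: T).
  apply/asboolP => f fT fP; apply: contrapT => /eqP f0; apply: nog.
  by exists f; split=> //; exact: lead_coef_univ_notin iT fT f0.
by move=> /Tmax; rewrite subsetUr => /(_ isT) eT; rewrite -eT setU11 in yT.
Qed.

Lemma independent_mod_sub T : independent_mod T -> T \subset G.
Proof.
move=> iT; apply/subsetP => v vT; rewrite inE; apply/negP => /iT Xv0.
have : X v = 0.
  apply: Xv0 => m; rewrite -mcoeff_msupp msuppX inE => /eqP->.
  by rewrite msupportU sub1set.
by move/(congr1 (mcoeff U_(enum_rank v))); rewrite mcoeffX eqxx mcoeff0 => /eqP;
  rewrite oner_eq0.
Qed.

Definition elem_sym j : S := \sum_(B : {set V} | (B \subset W) && (#|B| == j)) Xset k B.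

Fixpoint elem_syms d : seq S := if d is d'.+1 then elem_sym d :: elem_syms d' else [::].

Lemma size_elem_syms d : size (elem_syms d) = d.
Proof. by elim: d => //= d ->. Qed.

Lemma elem_syms_in_prime d : {subset elem_syms d <= P}.
Proof.
elim: d => //= d IH f; rewrite inE => /predU1P[->|]; last exact: IH.
apply: rpred_sum => B /andP[BW /eqP cB].
have [|v vB] := @set0Pn _ B _; first by rewrite -cards_eq0 cB.
rewrite /Xset (bigD1 v) //= mulrC; apply: idealMr.
by move: (subsetP BW _ vB); rewrite !inE negbK.
Qed.

(* Think of K F as the ideal of the simplex F. Modulo K F the polynomial e_|F| is
   the monomial X_F, and K F + (X_F) is filtered by the ideals K (F :\ b), on
   which the next elementary symmetric polynomials are regular by induction. *)
Lemma elem_syms_loc_regular (K : {set V} -> set S) :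
  (forall F, ideal (K F)) ->
  (forall F v, v \in W -> v \notin F -> K F (X v)) ->
  (forall F b f, F \subset W -> b \in F -> K F (X b * f) -> K F f) ->
  (forall F b, F \subset W -> b \in F -> addi (K F) (X b) = K (F :\ b)) ->
  forall F, F \subset W -> loc_regular P (K F) (elem_syms #|F|).
Proof.
move=> Ki KX Kb KaddX F; move eF : #|F| => d; elim: d F eF => //= d IH F eF FW.
have XsetD1 (A : {set V}) b : b \in A -> Xset k A = X b * Xset k (A :\ b).
  by move=> bA; rewrite /Xset (big_setD1 b).
have Xset_nzd n (A : {set V}) f :
    #|A| = n -> A \subset F -> K F (Xset k A * f) -> K F f.
  elim: n A => [|n IHn] A; first by move/cards0_eq->; rewrite /Xset big_set0 mul1r.
  move=> cA AF; have [b bA] : exists b, b \in A.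
    by apply/set0Pn; rewrite -card_gt0 cA.
  rewrite (XsetD1 _ b bA) -mulrA => /Kb-/(_ FW (subsetP AF _ bA)).
  apply: IHn; last exact: subset_trans (subD1set _ _) AF.
  by move: cA; rewrite (cardsD1 b) bA => -[].
have [_ KD KM] := Ki F.
(* Every other term of this degree contains a variable of W outside F, hence lies in [K F]. *)
have Ke : K F (elem_sym d.+1 - Xset k F).
  rewrite /elem_sym (bigD1 F) /= ?FW ?eF ?eqxx // [X in X - _]addrC addrK.
  apply: ideal_sum => // B /andP[/andP[BW /eqP cB] BF].
  have /subsetPn[v vB vF] : ~~ (B \subset F).
    by apply: contra BF => BF; rewrite eqEcard BF cB eF leqnn.
  rewrite (XsetD1 _ _ vB) mulrC; apply: (KM); apply: KX => //.
  exact: (subsetP BW).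
split=> [f Kf|].
  exists 1; rewrite ?idealr1 // mul1r; apply: (Xset_nzd d.+1 F) => //.
  rewrite -[Xset k F](subKr (elem_sym d.+1)) mulrBl; apply: idealB => //.
  by rewrite mulrC; apply: (KM).
rewrite (addi_congr (Ki F) Ke).
have sub n B : #|B| = n -> B \subset F ->
    loc_regular P (addi (K F) (Xset k B)) (elem_syms d); last exact: sub eF _.
elim: n B => [|n IHn] B cB BF.
  rewrite (cards0_eq cB) /Xset big_set0; apply: (@loc_regular_unit _ _ _ _ 1).
  - exact: addi_ideal.
  - exact: mem_addi.
  - by rewrite idealr1.
have [b bB] : exists b, b \in B by apply/set0Pn; rewrite -card_gt0 cB.
have bF := subsetP BF b bB.
have cB' : #|B :\ b| = n by move: cB; rewrite (cardsD1 b) bB => -[].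
have B'F := subset_trans (subD1set B b) BF.
(* Multiplication by X_b: the colon ideal of K F + (X_B) by X_b is K F + (X_(B - b)), handled by the
   induction on B, and adding X_b gives K (F - b), handled by the induction on F. For empty B the
   quotient was zero. *)
apply: (@loc_regular_extension _ P _ (addi (K F) (Xset k (B :\ b)))
  (addi (addi (K F) (Xset k B)) (X b)) (X b)) => //.
- exact: addi_ideal.
- exact: addi_ideal.
- by apply: addi_ideal; apply: addi_ideal.
- move=> _ [f [g [Kf ->]]]; rewrite (XsetD1 _ _ bB); exists (X b * f), g.
  by split; [exact: (KM)|rewrite mulrDr mulrCA].
- move=> f [g [h [Kg ef]]]; exists 1; rewrite ?idealr1 // mul1r.
  exists (f - h * Xset k (B :\ b)), h; split; last by rewrite subrK.
  apply: (Kb F b) => //; rewrite mulrBr ef (XsetD1 _ _ bB) mulrCA addrK.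
  exact: Kg.
- exact: IHn.
have -> : addi (addi (K F) (Xset k B)) (X b) = K (F :\ b).
  rewrite -KaddX // addiC //; apply/seteqP; split; last exact: sub_addi.
  apply: addi_min => //; first exact: addi_ideal.
  have [_ _ AM] := addi_ideal (X b) (Ki F).
  by rewrite (XsetD1 _ _ bB) mulrC; apply: (AM); apply: mem_addi.
apply: IH; first by move: eF; rewrite (cardsD1 b) bF => -[].
exact: subset_trans (subD1set _ _) FW.
Qed.

Section Transcendence.
Variables (T : {set V}) (g : V -> S).
Hypothesis TG : T \subset G.
Hypothesis gP : forall y, y \notin T ->
  [/\ polynomial_in (y |: T) (g y), g y \in P & lead_coef (univ y (g y)) \notin P].

(** The relation [g y] involves only T and y, so adding it keeps the ideal extended in every other
    variable outside T. Hence [extended_loc_nzd] still applies to the next relation. *)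
Lemma relations_loc_regular (K : set S) (s : seq V) : ideal K -> uniq s ->
    (forall y, y \in s -> y \notin T /\ extended y K) ->
  loc_regular P K (map g s) /\
  forall z, z \notin T -> z \notin s -> extended z K ->
    extended z (foldl addi K (map g s)).
Proof.
elim: s K => //= y s IH K Ki /andP[ys us] Ks.
have [yT Ky] := Ks y (mem_head y s); have [gy gyP lgy] := gP yT.
have ext z : z \notin T -> z != y -> extended z K -> extended z (addi K (g y)).
  move=> zT zy Kz; apply: addi_extended => //; apply: univ_free gy _.
  by rewrite !inE negb_or zy.
have [||z zs|sreg sext] := IH (addi K (g y)); first exact: addi_ideal.
- by [].
- have [|zT Kz] := Ks z; first by rewrite inE zs orbT.
  by split=> //; apply: ext => //; apply: contraNneq ys => <-.
split; first by split=> //; apply: extended_loc_nzd lgy.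
move=> z zT; rewrite inE negb_or => /andP[zy zs] Kz.
by apply: sext => //; apply: ext.
Qed.

(* Locally at P the first part generates the maximal ideal up to the variables in
   P and up to radical; the second part takes care of the variables in P. *)
Definition parameters d : seq S :=
  map g (enum (G :\: T)) ++ elem_syms (d - #|G|).

Lemma size_parameters d : (#|G| <= d)%N -> size (parameters d) = (d - #|T|)%N.
Proof.
move=> Gd; rewrite size_cat size_map -cardE size_elem_syms cardsD.
rewrite (setIidPr TG) addnC; have := subset_leq_card TG.
by move=> TG'; rewrite addnBA // subnK.
Qed.

Lemma parameters_in_prime d : {subset parameters d <= P}.
Proof.
move=> f; rewrite mem_cat => /orP[/mapP[y]|]; last exact: elem_syms_in_prime.
by rewrite mem_enum inE => /andP[yT _] ->; case: (gP yT).
Qed.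

Lemma parameters_loc_regular_simplex F :
  loc_regular P (SR (powerset F)) (parameters #|F|).
Proof.
have pdown := @powerset_downclosed V.
(* If some v in G lies outside F, then [X v] is a unit at P contained in SR(F), and the localized
   quotient is zero. *)
have [GF|/subsetPn[v]] := boolP (G \subset F); last first.
  rewrite inE => vP vF; apply: (@loc_regular_unit _ _ _ _ (X v)) => //.
    exact: stanley_reisner_ideal.
  apply: Xv_mem_stanley_reisner => //.
  by rewrite powersetE sub1set.
(* The simplex on G and F' together with all relations. This family, with F' inside W, satisfies the
   hypotheses of [elem_syms_loc_regular]; the instance wanted is F' = F minus G. *)
pose K F' := foldl addi (SR (powerset (G :|: F'))) (map g (enum (G :\: T))).
have SRi F' : ideal (SR (powerset (G :|: F'))) by apply: stanley_reisner_ideal.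
have rel F' := @relations_loc_regular _ (enum (G :\: T)) (SRi F') (enum_uniq _).
have ext F' y : y \in enum (G :\: T) ->
    y \notin T /\ extended y (SR (powerset (G :|: F'))).
  rewrite mem_enum inE => /andP[yT yG]; split=> //.
  by apply: stanley_reisner_extended; rewrite inE yG.
have eF : F = G :|: F :\: G.
  apply/setP=> v; rewrite [RHS]inE [in RHS]in_setD.
  by case: (boolP (v \in G)) => // /(subsetP GF).
apply: loc_regular_cat.
  by rewrite eF; apply: (proj1 (rel _ _)) => y; apply: ext.
rewrite (_ : foldl _ _ _ = K (F :\: G)); last by rewrite /K -eF.
have -> : (#|F| - #|G| = #|F :\: G|)%N by rewrite cardsD (setIidPr GF).
apply: elem_syms_loc_regular; last by apply/subsetP => v; rewrite !inE => /andP[].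
- by move=> F'; apply: foldl_addi_ideal.
- move=> F' v vG vF'; apply: foldl_addi_sub; apply: Xv_mem_stanley_reisner => //.
  by move: vG; rewrite powersetE sub1set inE => /negPf vG; rewrite inE vG.
- move=> F' b f F'W bF' Kf; have bG := subsetP F'W b bF'.
  have bG' : b \notin G by rewrite -in_setC.
  apply: extended_Xv Kf _; last exact: foldl_addi_ideal.
  apply: (proj2 (rel F' (ext F'))).
  + by apply: contra bG'; apply: (subsetP TG).
  + by rewrite mem_enum inE (negPf bG') andbF.
  + by apply: stanley_reisner_extended; rewrite inE bF' orbT.
- move=> F' b F'W bF'; rewrite foldl_addiC // stanley_reisner_del //.
  rewrite (_ : del _ b = powerset (G :|: F' :\ b)) //.
  have : b \notin G by rewrite -in_setC; apply: (subsetP F'W).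
  move=> bG; apply/setP=> A; rewrite !inE.
  rewrite -subsetD1 (_ : (G :|: F') :\ b = G :|: F' :\ b) //.
  apply/setP=> z; rewrite in_setD1 !in_setU in_setD1.
  by case: (eqVneq z b) => [->|] //; rewrite (negPf bG).
Qed.

Lemma parameters_loc_regular d D : nice d D -> downclosed D ->
  loc_regular P (SR D) (parameters d).
Proof.
elim=> {d D}[F _|d D x _ _ IHs _ IHd Dd]; first exact: parameters_loc_regular_simplex.
have sd := @star_downclosed _ D x Dd; have dd := @del_downclosed _ D x Dd.
apply: (@loc_regular_extension _ P _ _ _ (X x) _ _ _ _ _ _ _ (IHs sd) (IHd dd)).
- exact: stanley_reisner_ideal.
- exact: stanley_reisner_ideal.
- exact: stanley_reisner_ideal.
- by move=> f /stanley_reisner_colon.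
- move=> f /stanley_reisner_colon Kf; exists 1; rewrite ?idealr1 //.
  by rewrite mul1r.
- by rewrite stanley_reisner_del.
Qed.

End Transcendence.

End SystemOfParameters.

(** * Dimension of Stanley-Reisner rings *)

Section Dimension.
Variables (k : fieldType) (V : finType).
Local Open Scope ring_scope.
Local Notation S := {mpoly k[#|V|]}.
Local Notation X := (@vertex_var k V).
Local Notation SR := (@stanley_reisner k V).
Implicit Types (D : {set {set V}}) (F T A : {set V}) (f g : S).

Definition deg_le d f : Prop := forall m, f@_m != 0 -> (mdeg m <= d)%N.

Lemma deg_leM d e f g : deg_le d f -> deg_le e g -> deg_le (d + e) (f * g).
Proof.
move=> fd ge m; rewrite -mcoeff_msupp => /msuppM_le/allpairsP[[m1 m2] /= [m1f m2g ->]].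
by rewrite mdegD leq_add ?fd ?ge // -mcoeff_msupp.
Qed.

Lemma deg_le1 : deg_le 0 (1 : S).
Proof. by move=> m; rewrite -mcoeff_msupp msupp1 inE => /eqP->; rewrite mdeg0. Qed.

Lemma deg_leX d n f : deg_le d f -> deg_le (d * n) (f ^+ n).
Proof.
move=> fd; elim: n => [|n IH]; first by rewrite muln0 expr0; apply: deg_le1.
by rewrite exprS mulnS; apply: deg_leM.
Qed.

Lemma deg_le_prod (I : finType) d (z : I -> S) : (forall i, deg_le d (z i)) ->
  deg_le (#|I| * d) (\prod_i z i).
Proof.
move=> zd; rewrite -sum_nat_const.
elim/big_rec2: _ => [|i e f _ fe]; first exact: deg_le1.
exact: deg_leM.
Qed.

Lemma deg_le_leq d e f : (d <= e)%N -> deg_le d f -> deg_le e f.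
Proof. by move=> de fd m /fd/leq_trans; apply. Qed.

Lemma deg_le_family (I : finType) (z : I -> S) : exists d, forall i, deg_le d (z i).
Proof.
exists (\max_i msize (z i)) => i m; rewrite -mcoeff_msupp => /msize_mdeg_lt/ltnW.
by move=> /leq_trans; apply; apply: leq_bigmax.
Qed.

(** For B = (a+1)^f one has (a B + 1)^f <= ((a+1)(B+1))^f = B (B+1)^f < (B+1)^(f+1) <= (B+1)^N. *)
Lemma exp_box_bound (a f N : nat) : (f < N)%N ->
  exists B, ((a * B).+1 ^ f < B.+1 ^ N)%N.
Proof.
move=> fN; exists (a.+1 ^ f)%N; set B := (a.+1 ^ f)%N.
have le1 : ((a * B).+1 <= a.+1 * B.+1)%N by rewrite mulSn mulnS; lia.
apply: (@leq_ltn_trans ((a.+1 * B.+1) ^ f)).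
  by case: f {fN} => // f in B le1 *; rewrite leq_exp2r.
rewrite expnMn -/B; apply: (@leq_trans (B.+1 ^ f.+1)); last by rewrite leq_pexp2l.
by rewrite expnS ltn_pmul2r ?expn_gt0.
Qed.

(* Counting: the products [z^a] with exponents [a_i < B] number [B^|I|], whereas
   modulo SR(F) they lie in a space of dimension O(B^|F|). *)
Lemma powers_dependent F (I : finType) (z : I -> S) : (#|F| < #|I|)%N ->
  exists B (c : {ffun I -> 'I_B} -> k), (exists a, c a != 0) /\
    SR (powerset F) (\sum_a c a *: \prod_i z i ^+ a i).
Proof.
move=> ltFI; have [d zd] := deg_le_family z.
have [B ltB] := exp_box_bound (#|I| * d)%N ltFI.
(* The products have degree at most |I| d B, so every exponent occurring in one of their monomials
   is below C. *)
pose C := (#|I| * d * B).+1.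
pose E := {ffun I -> 'I_B.+1}; pose U := {ffun {v : V | v \in F} -> 'I_C}.
pose mon (u : U) : 'X_{1..#|V|} :=
  [multinom if insub (enum_val i) is Some w then u w : nat else 0%N | i < #|V|].
pose zp (a : E) := \prod_i z i ^+ a i.
(* Coefficients of the products at the monomials supported in F. By [ltB] there are more rows than
   columns, so the left kernel is nonzero, and a nonzero row of it is the relation sought. *)
pose M := \matrix_(i < #|E|, j < #|U|) (zp (enum_val i))@_(mon (enum_val j)).
have rk : kermx M != 0.
  rewrite -mxrank_eq0 mxrank_ker -lt0n subn_gt0.
  apply: leq_ltn_trans (rank_leq_col M) _.
  by rewrite !card_ffun !card_ord card_sig.
have [i ri] : exists i, row i (kermx M) != 0.
  apply/existsP; apply: contraNT rk; rewrite negb_exists => /forallP r0.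
  by apply/eqP/row_matrixP => i; rewrite row0; apply/eqP; rewrite -[_ == _]negbK.
pose c (a : E) := kermx M i (enum_rank a).
exists B.+1, c; split.
  apply/existsP; apply: contraNT ri; rewrite negb_exists => /forallP c0.
  apply/eqP/rowP => j; rewrite mxE [RHS]mxE; apply/eqP.
  by have := c0 (enum_val j); rewrite negbK /c enum_valK.
move=> m; rewrite powersetE => mF; rewrite raddf_sum /=.
have [mC|mC] := boolP [forall v, m (enum_rank v) < C]%N; last first.
  rewrite big1 // => a _; rewrite mcoeffZ.
  suff -> : (\prod_i z i ^+ a i)@_m = 0 by rewrite mulr0.
  apply: contraNeq mC => am; apply/forallP => v; rewrite ltnS.
  have : deg_le (#|I| * d * B) (\prod_i z i ^+ a i).
    rewrite -mulnA; apply: deg_le_prod => j.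
    apply: (@deg_le_leq (d * a j)); last exact: deg_leX.
    by rewrite leq_mul2l -ltnS ltn_ord orbT.
  move=> /(_ _ am); apply: leq_trans.
  by rewrite mdegE (bigD1 (enum_rank v)) //= leq_addr.
pose u : U := [ffun w => inord (m (enum_rank (val w)))].
have -> : m = mon u.
  apply/mnmP => j; rewrite mnmE; case: insubP => [w _ ew|jF].
    rewrite ffunE ew enum_valK inordK //.
    by have := forallP mC (enum_val j); rewrite enum_valK.
  apply/eqP; apply: contraNT jF => mj; apply: (subsetP mF).
  by rewrite inE enum_valK.
transitivity ((kermx M *m M) i (enum_rank u)); last by rewrite mulmx_ker mxE.
rewrite mxE.
rewrite (reindex (@enum_val _ E)) /=; last first.
  by exists enum_rank => ? _; rewrite ?enum_valK ?enum_rankK.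
by apply: eq_bigr => j _; rewrite mcoeffZ [M _ _]mxE enum_rankK /c enum_valK.
Qed.

(** Otherwise the product of these variables would be a monomial of SR(D), hence in P, although none
    of its factors is. *)
Lemma unit_vars_face D (P : prime_idealr S) : (SR D `<=` [set` P])%classic ->
  downclosed D -> unit_vars P \in D.
Proof.
move=> DP Dd; apply: contraT => GD.
suff : Xset k (unit_vars P) \in P.
  rewrite /Xset; elim/big_rec: _ => [|v f]; first by rewrite idealr1.
  by rewrite inE prime_idealrM => /negPf->.
apply: DP => m Dm; rewrite /Xset.
have -> : \prod_(v in unit_vars P) X v =
    'X_[\sum_(v in unit_vars P) U_(enum_rank v)].
  by elim/big_rec2: _ => [|v m' f _ ->]; rewrite ?mpolyX0 // mpolyXD.
rewrite mcoeffX; case: eqP => // em; case/negP: GD; apply: Dd Dm.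
apply/subsetP => v vG; rewrite -em (bigD1 v) //= msupportD msupportU.
by rewrite !inE eqxx.
Qed.

Lemma mem_prime_msupport (P : prime_idealr S) f :
  (forall m, f@_m != 0 -> exists2 v, v \in msupport m & X v \in P) -> f \in P.
Proof.
move=> fP; rewrite [f]mpolyE big_seq; apply: rpred_sum => m.
rewrite mcoeff_msupp => /fP[v vm vP]; rewrite -mul_mpolyC; apply: idealMr.
rewrite -lemU_msupport in vm; rewrite -(submK vm) mpolyXD; exact: idealMr.
Qed.

Lemma unit_vars_sub (P : prime_idealr S) :
  (SR (powerset (unit_vars P)) `<=` [set` P])%classic.
Proof.
move=> f If; apply: mem_prime_msupport => m fm.
have : ~~ (msupport m \subset unit_vars P).
  by apply: contraNN fm => mG; rewrite If // powersetE.
by case/subsetPn => v vm; rewrite inE negbK; exists v.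
Qed.

Local Open Scope classical_set_scope.

(* Pick w_i in c_(i+1) but not in c_i. With the variables of T these are too many
   elements to be independent modulo SR(F), and the lexicographically smallest
   monomials of a relation, extracted along the chain, give a relation on T. *)
Lemma chain_transcendence n (c : nat -> prime_idealr S) T F :
  (forall i, (i < n)%N -> [set` c i] `<` [set` c i.+1]) ->
  SR (powerset F) `<=` [set` c 0%N] -> independent_mod (c n) T ->
  (n + #|T| <= #|F|)%N.
Proof.
move=> cmon Fc iT; rewrite leqNgt; apply/negP => ltF.
have /choice[w Hw] : forall i : 'I_n, exists z, z \in c i.+1 /\ z \notin c i.
  move=> i; have [_] := cmon i (ltn_ord i).
  by move=> /nonsubset[z [cz ncz]]; exists z; split=> //; apply/negP.
pose I : finType := ('I_n + {v : V | v \in T})%type.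
pose z (i : I) : S := match i with inl i => w i | inr v => X (val v) end.
have [|B [a [[a0 a0nz] sumF]]] := @powers_dependent F I z.
  by rewrite card_sum card_ord card_sig.
pose E := {ffun I -> 'I_B}.
pose tail (b : E) : S := \prod_(v : {v : V | v \in T}) X (val v) ^+ b (inr v).
pose mon i (b : E) := (\prod_(j < n | (i <= j)%N) w j ^+ b (inl j)) * tail b.
(* Invariant: [A] holds exponents that agree on w_0, ..., w_(i-1), and their terms, with these
   factors cancelled, sum to an element of [c i]. *)
have step i : (i <= n)%N -> exists A : {set E},
    [/\ (exists b, b \in A), forall b, b \in A -> a b != 0,
        forall b b' (j : 'I_n), b \in A -> b' \in A -> (j < i)%N ->
          b (inl j) = b' (inl j)
      & \sum_(b in A) a b *: mon i b \in c i].
  elim: i => [_|i IH lt_in].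
    exists [set b | a b != 0]%SET; split=> //.
    - by exists a0; rewrite inE.
    - by move=> b; rewrite inE.
    suff -> : \sum_(b in [set b : E | a b != 0]%SET) a b *: mon 0%N b =
      \sum_b a b *: \prod_i z i ^+ b i by apply: Fc.
    rewrite big_mkcond; apply: eq_bigr => b _; rewrite inE.
    case: eqP => [->|_]; first by rewrite !scale0r.
    by rewrite big_sumType.
  have [A [[b0 b0A] Anz Aeq sumA]] := IH (ltnW lt_in).
  pose i' := Ordinal lt_in.
  (* The smallest power of w_i can be cancelled because w_i is outside [c i]. Since w_i lies in the
     next prime, the terms where a positive power remains drop out there, leaving those of minimal
     exponent. *)
  have [b1 b1A b1min] := arg_minnP (fun b : E => b (inl i') : nat) b0A.
  pose e : nat := b1 (inl i').
  have [wi wi'] := Hw i'.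
  pose rest (b : E) := w i' ^+ (b (inl i') - e) * mon i.+1 b.
  have monE b : b \in A -> mon i b = w i' ^+ e * rest b.
    move=> bA; rewrite /rest mulrA -exprD subnKC ?b1min // /mon mulrA.
    congr (_ * _); rewrite (bigD1 i') //=; congr (_ * _); apply: eq_bigl => j.
    by rewrite andbC -[RHS]/(i < j)%N ltn_neqAle eq_sym.
  have : \sum_(b in A) a b *: rest b \in c i.
    have : w i' ^+ e * (\sum_(b in A) a b *: rest b) \in c i.
      rewrite mulr_sumr; suff <- : \sum_(b in A) a b *: mon i b =
        \sum_(b in A) w i' ^+ e * (a b *: rest b) by [].
      by apply: eq_bigr => b bA; rewrite monE // scalerAr.
    rewrite prime_idealrM => /orP[|//].
    by move: (notin_primeX e wi') => /negPf->.
  move/(properW (cmon i lt_in)) => /= sumr.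
  exists [set b in A | b (inl i') == b1 (inl i')]%SET; split.
  - by exists b1; rewrite inE eqxx andbT; exact: b1A.
  - by move=> b; rewrite inE => /andP[/Anz].
  - move=> b b' j; rewrite !inE => /andP[bA /eqP eb] /andP[bA' /eqP eb'].
    rewrite ltnS leq_eqVlt => /predU1P[ej|]; last exact: Aeq.
    by rewrite (_ : j = i') ?eb ?eb' //; apply: val_inj.
  move: sumr; rewrite (bigID (fun b : E => b (inl i') == b1 (inl i'))) /=.
  rewrite addrC rpredDl => [|]; last first.
    apply: rpred_sum => b /andP[bA nb]; rewrite -mul_mpolyC /rest mulrCA mulrC.
    have : (0 < b (inl i') - e)%N.
      by rewrite subn_gt0 ltn_neqAle b1min // andbT eq_sym -val_eqE in nb *.
    case: (_ - _)%N => // q _; rewrite exprS mulrCA -!mulrA mulrC -mulrA.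
    by apply: idealMr; apply: idealMr.
  rewrite (_ : \sum_(b in _ | _) _ =
    \sum_(b in [set b in A | b (inl i') == b1 (inl i')]%SET) a b *: mon i.+1 b) //.
  apply: eq_big => [b|b /andP[_ /eqP eb]]; first by rewrite inE.
  by rewrite /rest eb subnn expr0 mul1r.
(* Only variables of T remain. The exponents in [A] agree on all w_j, so distinct ones give distinct
   monomials, and a nonzero polynomial in T lies in [c n]. *)
have [A [[b0 b0A] Anz Aeq sumA]] := step n (leqnn n).
pose mt (b : E) : 'X_{1..#|V|} :=
  (\sum_(v : {v : V | v \in T}) U_(enum_rank (val v)) *+ b (inr v))%MM.
have tailE b : mon n b = 'X_[mt b].
  rewrite /mon big1 ?mul1r => [|j]; last by rewrite leqNgt ltn_ord.
  rewrite /tail /mt; elim/big_rec2: _ => [|v m f _ ->]; first by rewrite mpolyX0.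
  by rewrite mpolyXD /vertex_var mpolyXn.
have mtE b (v : {v : V | v \in T}) : mt b (enum_rank (val v)) = b (inr v).
  rewrite /mt mnm_sumE (bigD1 v) //= mulmnE mnm1E eqxx mul1n big1 ?addn0 //.
  move=> u uv; rewrite mulmnE mnm1E (inj_eq enum_rank_inj) val_eqE (negPf uv).
  by [].
have := iT _ _ sumA; have -> : \sum_(b in A) a b *: mon n b =
   \sum_(b in A) a b *: 'X_[mt b] by apply: eq_bigr => b _; rewrite tailE.
move=> h; have /h/(congr1 (mcoeff (mt b0))) :
    polynomial_in T (\sum_(b in A) a b *: 'X_[mt b]).
  move=> m; rewrite raddf_sum /= => nz.
  have [b bA] : exists2 b, b \in A & (a b *: 'X_[mt b])@_m != 0.
    apply: contrapT => no; case/eqP: nz; apply: big1 => b bA.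
    by apply: contrapT => /eqP nzb; apply: no; exists b.
  rewrite mcoeffZ mcoeffX; case: (mt b =P m) => [<- _|_]; last by rewrite mulr0 eqxx.
  apply/subsetP => v; rewrite inE; apply: contraNT => vT.
  rewrite /mt mnm_sumE big1 // => u _; rewrite mulmnE mnm1E.
  rewrite (inj_eq enum_rank_inj); case: eqP => // uv.
  by rewrite -uv (valP u) in vT.
rewrite raddf_sum /= (bigD1 b0) //= mcoeffZ mcoeffX eqxx mulr1 big1.
  by rewrite addr0 mcoeff0 => /eqP; apply/negP/Anz.
move=> b /andP[bA nb]; rewrite mcoeffZ mcoeffX.
case: eqP => [emt|]; last by rewrite mulr0.
case/eqP: nb; apply/ffunP => -[j|v]; first exact: Aeq.
by apply: val_inj; rewrite /= -!mtE emt.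
Qed.

(** The smallest prime contains the ideal of the simplex on its unit variables, which form a face of
    D, so the bound for a simplex applies to that face. *)
Lemma chain_length D n (c : nat -> prime_idealr S) T d : downclosed D ->
  (forall F, F \in D -> (#|F| <= d)%N) ->
  (forall i, (i < n)%N -> [set` c i] `<` [set` c i.+1]) ->
  SR D `<=` [set` c 0%N] -> independent_mod (c n) T ->
  (n + #|T| <= d)%N.
Proof.
move=> Dd Dcard cmon Dc iT; apply: leq_trans (Dcard _ (unit_vars_face Dc Dd)).
exact: chain_transcendence cmon (@unit_vars_sub _) iT.
Qed.

Lemma independent_mod_subset (P Q : prime_idealr S) T :
  [set` Q] `<=` [set` P] -> independent_mod P T -> independent_mod Q T.
Proof. by move=> QP iT f fT /QP; apply: iT. Qed.

Lemma face_chain D A F n : downclosed D -> F \in D -> A \subset F ->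
  (n <= #|F :\: A|)%N ->
  exists c : nat -> prime_idealr S,
    [/\ forall i, SR D `<=` [set` c i] /\ [set` c i] `<=` SR (powerset A) &
        forall i, (i < n)%N -> [set` c i] `<` [set` c i.+1]].
Proof.
(* Vertices of F outside A are removed one at a time: the faces shrink towards A while their primes
   grow. *)
move=> Dd FD AF le_n; pose B i := A :|: [set v in drop i (enum (F :\: A))]%SET.
have /choice[c Hc] : forall i, exists Q : prime_idealr S,
  [set` Q] = SR (powerset (B i)) by move=> i; apply: stanley_reisner_prime.
have BF i : B i \subset F.
  rewrite subUset AF; apply/subsetP => v; rewrite inE => /mem_drop.
  by rewrite mem_enum inE => /andP[].
exists c; split=> i; rewrite ?Hc.
  split; apply: stanley_reisner_sub; apply/subsetP => C; rewrite !powersetE.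
    by move=> CB; apply: Dd FD; apply: subset_trans (BF i).
  by move=> CA; apply: subset_trans CA (subsetUl _ _).
move=> lt_in; have lt_i : (i < size (enum (F :\: A)))%N.
  by rewrite -cardE; apply: leq_trans lt_in le_n.
have v0 : V by case: (enum _) lt_i => // v.
have dropE := drop_nth v0 lt_i; set v := nth _ _ _ in dropE.
split.
  apply: stanley_reisner_sub; apply/subsetP => C; rewrite !powersetE => /subset_trans.
  apply; rewrite /B setUS //; apply/subsetP => u; rewrite !inE dropE inE => ->.
  by rewrite orbT.
have vB : v \notin B i.+1.
  have := enum_uniq (F :\: A); rewrite -(cat_take_drop i (enum _)) cat_uniq dropE.
  move=> /and3P[_ _ /= /andP[vd _]]; rewrite !inE (negPf vd) orbF.
  have : v \in enum (F :\: A) by rewrite mem_nth.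
  by rewrite mem_enum inE => /andP[].
have Xv : SR (powerset (B i.+1)) (X v).
  by apply: Xv_mem_stanley_reisner; rewrite ?powersetE ?sub1set //;
    apply: powerset_downclosed.
move=> /(_ (X v) Xv)/(_ U_(enum_rank v)%MM); rewrite msupportU powersetE sub1set.
rewrite !inE dropE inE eqxx orbT => /(_ isT)/eqP.
by rewrite mcoeffX eqxx oner_eq0.
Qed.

Lemma dim_ge_stanley_reisner D n : downclosed D ->
  dim_ge (SR D) n <-> exists2 F, F \in D & (n <= #|F|)%N.
Proof.
move=> Dd; split=> [[c [Dc cmon]]|[F FD le_n]].
  have D0 := unit_vars_face (Dc 0%N isT) Dd; exists (unit_vars (c 0%N)) => //.
  have := chain_transcendence cmon (@unit_vars_sub _) (@independent_mod0 _ _ (c n)).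
  by rewrite cards0 addn0.
have [||c [Dc cmon]] := @face_chain D set0 F n Dd FD; rewrite ?sub0set ?setD0 //.
by exists c; split=> // i _; case: (Dc i).
Qed.

Lemma nice_cohen_macaulay D d : nice d D -> downclosed D ->
  (forall F, F \in D -> (#|F| <= d)%N) -> quot_cohen_macaulay (SR D).
Proof.
move=> nD Dd Dcard P n; have SRi := stanley_reisner_ideal k Dd.
split; first by apply: dim_ge_depth_ge; apply: ideal_loc_ideal.
move=> /dim_ge_loc[//|c [Dc cmon]].
have [T [iT hg]] := maximal_independent_mod P.
have [_ cP] := Dc n (leqnn n); have [Dc0 _] := Dc 0%N (leq0n n).
have DP : SR D `<=` [set` P] by move=> f /(proj1 (Dc n (leqnn n)))/cP.
have /choice[g gP] : forall y, exists g, y \notin T ->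
    [/\ polynomial_in (y |: T) g, g \in P & lead_coef (univ y g) \notin P].
  by move=> y; have [yT|/hg[g]] := boolP (y \in T); [exists 0|exists g].
have TG := independent_mod_sub iT.
have := chain_length Dd Dcard cmon Dc0 (independent_mod_subset cP iT).
move=> le_nd.
apply: (@depth_ge_loc _ P _ (parameters P T g d)) => //.
- exact: parameters_in_prime.
- exact: parameters_loc_regular nD Dd.
rewrite size_parameters //; first by rewrite -(leq_add2r #|T|) subnK //; 
  apply: leq_trans le_nd; apply: leq_addl.
exact/Dcard/unit_vars_face.
Qed.

End Dimension.

(** * Edge ideals and condition S_2 *)

Section NotDepthTwo.
Variables (A : comNzRingType) (m J I1 I2 : set A).
Local Open Scope ring_scope.
Local Open Scope classical_set_scope.

(* The punctured spectrum of A/J is disconnected by I1 and I2. *)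
Lemma not_depth_ge2 (y1 y2 : A) : ideal m -> ideal J -> ideal I1 -> ideal I2 ->
  ~ m 1 -> (forall c, m c \/ exists u, u * c = 1) ->
  (forall a, m a -> exists a1 a2, [/\ I1 a1, I2 a2 & a = a1 + a2]) ->
  (forall a b, I1 a -> I2 b -> J (a * b)) ->
  J `<=` I1 -> J `<=` I2 -> I1 y1 -> ~ J y1 -> I2 y2 -> ~ J y2 ->
  ~ depth_ge m J 2.
Proof.
move=> mi Ji I1i I2i m1 mu msplit I12 JI1 JI2 Iy1 Jy1 Iy2 Jy2.
have [J0 JD JM] := Ji; have [_ I1D I1M] := I1i; have [_ I2D I2M] := I2i.
move=> [[|a [|b [|? ?]]] [//= _ sm [sreg _]]].
have areg c : J (a * c) -> J c.
  by have := sreg 0%N isT c; rewrite /= quot_seq_nil.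
have breg c : addi J a (b * c) -> addi J a c.
  have := sreg 1%N isT c; rewrite /= quot_seq_cons // quot_seq_nil //.
  exact: addi_ideal.
have [|a1 [a2 [Ia1 Ia2 ea]]] := msplit a; first by apply: sm; rewrite /= mem_head.
have [|b1 [b2 [Ib1 Ib2 eb]]] := msplit b.
  by apply: sm; rewrite /= !inE eqxx orbT.
(* Modulo J the mixed products vanish, so b a1 = b1 a1 = b1 a, and regularity of b modulo a puts a1
   in J + (a). *)
have [|j [c [Jj ea1]]] := breg a1.
  exists (a1 * b2 - b1 * a2), b1; split.
    by apply: idealB => //; apply: I12.
  by rewrite ea eb; ring.
have eJ : (1 - c) * a1 - c * a2 = j by rewrite mulrBl mul1r {1}ea1 ea; ring.
have unit_or : (exists u, u * (1 - c) = 1) \/ exists u, u * c = 1.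
  have [m1c|] := mu (1 - c); last by left.
  have [mc|] := mu c; last by right.
  by case: m1; rewrite -(subrK c 1); case: mi => _ mD _; apply: mD.
(* If 1 - c is a unit, (1 - c) a1 = j + c a2 puts a1, hence a, into I2; then a kills y1 modulo J,
   against regularity. If c is a unit, a lies in I1 and kills y2. *)
case: unit_or => -[u eu].
  apply: Jy1; apply: areg; rewrite ea mulrDl; apply: (JD); last first.
    by rewrite mulrC; apply: I12.
  rewrite mulrC; apply: I12 => //.
  rewrite -[a1]mul1r -eu -mulrA (_ : (1 - c) * a1 = j + c * a2).
    by apply: (I2M); apply: (I2D); [exact: JI2|exact: (I2M)].
  by rewrite -eJ subrK.
apply: Jy2; apply: areg; rewrite ea mulrDl; apply: (JD); first exact: I12.
apply: I12 => //.
rewrite -[a2]mul1r -eu -mulrA (_ : c * a2 = (1 - c) * a1 - j).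
  by apply: (I1M); apply: idealB => //; [exact: (I1M)|exact: JI1].
by rewrite -eJ; ring.
Qed.

End NotDepthTwo.

Section EdgeIdeal.
Variables (k : fieldType) (V : finType) (G : sgraph V).
Local Open Scope ring_scope.
Local Notation S := {mpoly k[#|V|]}.
Local Notation X := (@vertex_var k V).
Local Notation SR := (@stanley_reisner k V).
Local Notation IC := (indep_complex G).
Implicit Types (A F : {set V}) (f g : S).

Lemma independentP A :
  reflect (forall u v, u \in A -> v \in A -> ~~ G u v) (independent G A).
Proof.
apply: (iffP forall_inP) => [iA u v uA vA|iA u uA].
  by have /forall_inP := iA u uA; apply.
by apply/forall_inP => v; apply: iA.
Qed.

Lemma independent_sub A F : A \subset F -> independent G F -> independent G A.
Proof.
move=> /subsetP AF /independentP iF; apply/independentP => u v uA vA.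
by apply: iF; apply: AF.
Qed.

Lemma mem_indep A : (A \in IC) = independent G A.
Proof. by rewrite inE. Qed.

Lemma indep_downclosed : downclosed IC.
Proof. by move=> A F AF; rewrite !mem_indep; apply: independent_sub. Qed.

Lemma independent_set1 v : independent G [set v].
Proof.
by apply/independentP => a b; rewrite !inE => /eqP-> /eqP->; rewrite adj_irr.
Qed.

Lemma independent_set0 : independent G set0.
Proof. by apply/independentP => a b; rewrite inE. Qed.

Lemma independentU1 v A :
  independent G (v |: A) = independent G A && [forall u in A, ~~ G v u].
Proof.
apply/independentP/andP => [iA|[/independentP iA /forall_inP vA] a b]; last first.
  move=> /setU1P[->|aA] /setU1P[->|bA]; rewrite ?adj_irr //.
  - exact: vA.
  - by rewrite adj_sym; apply: vA.
  - exact: iA.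
split; first by apply/independentP => a b aA bA; apply: iA; rewrite inE ?aA ?bA orbT.
by apply/forall_inP => u uA; apply: iA; rewrite !inE ?eqxx ?uA ?orbT.
Qed.

Lemma edge_ideal_stanley_reisner : edge_ideal k G = SR IC.
Proof.
have SRi := stanley_reisner_ideal k indep_downclosed.
apply/seteqP; split.
  apply: ideal_gen_min => // _ [u [v [uv ->]]] m; rewrite mem_indep => im.
  rewrite mcoeff_XvM; case: ifP => // um; rewrite -[vertex_var k v]mulr1 mcoeff_XvM.
  case: ifP => // vm; have := independentP _ im u v um.
  by rewrite uv => /(_ (subsetP (msupportB _ _) _ vm)).
move=> f If; rewrite [f]mpolyE big_seq.
apply: (ideal_sum _ (ideal_gen_ideal _)) => m; rewrite mcoeff_msupp => fm.
have : ~~ independent G (msupport m).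
  by apply: contraNN fm => im; rewrite If // mem_indep.
rewrite negb_forall => /existsP[u]; rewrite negb_imply negb_forall.
move=> /andP[um /existsP[v]]; rewrite negb_imply negbK => /andP[vm uv].
have vu : v != u by apply: contraTneq uv => ->; rewrite adj_irr.
have vm' : v \in msupport (m - U_(enum_rank u)).
  rewrite inE mnmBE mnm1E (inj_eq enum_rank_inj) [u == v]eq_sym (negPf vu) subn0.
  by rewrite inE in vm.
rewrite -lemU_msupport in um; rewrite -lemU_msupport in vm'.
rewrite -(submK um) -(submK vm') !mpolyXD -mul_mpolyC -mulrA mulrA.
have [_ _ IM] := ideal_gen_ideal (edge_gens k G).
apply: (IM).
by apply: sub_gen_smallest; exists v, u; rewrite adj_sym.
Qed.

Lemma edge_ideal_del x :
  ideal_gen (edge_ideal k G `|` [set X x])%classic = SR (del IC x).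
Proof.
rewrite edge_ideal_stanley_reisner ideal_gen_addi.
  by rewrite stanley_reisner_del //; apply: indep_downclosed.
exact/stanley_reisner_ideal/indep_downclosed.
Qed.

Lemma del_same_dimP x : del_same_dim k G x <->
  forall F, independent G F ->
    exists F', [/\ independent G F', x \notin F' & (#|F| <= #|F'|)%N].
Proof.
have icd := indep_downclosed.
rewrite /del_same_dim edge_ideal_del edge_ideal_stanley_reisner.
have dd := @del_downclosed _ IC x icd.
split=> [sd F iF|ext n].
  have /sd : dim_ge (SR IC) #|F|.
    by apply/dim_ge_stanley_reisner => //; exists F; rewrite ?mem_indep.
  move=> /dim_ge_stanley_reisner-/(_ dd)[F']; rewrite inE mem_indep => /andP[iF' xF'].
  by exists F'.
rewrite !dim_ge_stanley_reisner //; split=> -[F].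
  rewrite mem_indep => /ext[F' [iF' xF' le]] le_n; exists F'.
    by rewrite inE mem_indep iF'.
  exact: leq_trans le_n le.
by rewrite inE => /andP[FD _] le_n; exists F.
Qed.

Lemma vertex_decomposable_cohen_macaulay :
  graph_pure G -> vertex_decomposable IC -> graph_cohen_macaulay k G.
Proof.
move=> pG vd; rewrite /graph_cohen_macaulay edge_ideal_stanley_reisner.
have icd := indep_downclosed; have IC0 : set0 \in IC.
  by rewrite mem_indep independent_set0.
have [F0 fF0 _] := facet_ext IC0.
apply: (@nice_cohen_macaulay k V IC #|F0|) => //.
  apply: vertex_decomposable_nice => //; first by apply/set0Pn; exists set0.
  by move=> F fF; apply: pG.
move=> F /facet_ext[F1 fF1 FF1]; rewrite (pG _ _ fF0 fF1).
exact: subset_leq_card.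
Qed.

Lemma cohen_macaulay_serre r : graph_cohen_macaulay k G -> graph_serre k G r.
Proof. by move=> CM P n _ /CM. Qed.

(** For independent A inside U, the vertex set of the link of A in the independence complex of the
    subgraph on U; that link is again the independence complex of an induced subgraph. *)
Definition residual (U A : {set V}) : {set V} :=
  [set u in U | (u \notin A) && independent G (u |: A)].

(* Unless it is a clique, the graph on every residual set has a connected
   complement. *)
Definition serre2_on (U : {set V}) : Prop := forall (A W1 W2 : {set V}) u v,
  A \subset U -> independent G A -> W1 != set0 -> W2 != set0 ->
  W1 :|: W2 = residual U A -> (forall a b, a \in W1 -> b \in W2 -> G a b) ->
  u \in residual U A -> v \in residual U A -> u != v -> G u v.

Lemma mcoeff_Xset_sub A f m : (Xset k A * f)@_m != 0 -> A \subset msupport m.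
Proof.
move=> nz; apply/subsetP => v vA; move: nz; rewrite /Xset (bigD1 v) //= -mulrA.
by rewrite mcoeff_XvM; case: ifP => //; rewrite eqxx.
Qed.

Lemma Xset_notin (P : prime_idealr S) A : (forall v, v \in A -> X v \notin P) ->
  Xset k A \notin P.
Proof.
move=> AP; rewrite /Xset; elim/big_rec: _ => [|v f vA fP]; first by rewrite idealr1.
by rewrite notin_primeM ?AP.
Qed.

Lemma Xv_stanley_reisner_powerset F v : SR (powerset F) (X v) <-> v \notin F.
Proof.
split=> [/(_ U_(enum_rank v)%MM)|vF]; last first.
  apply: Xv_mem_stanley_reisner; last exact: powerset_downclosed.
  by rewrite powersetE sub1set.
rewrite msupportU powersetE sub1set mcoeffX eqxx => h; apply/negP => /h/eqP.
by rewrite oner_eq0.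
Qed.

Lemma graph_serre_serre2_on : graph_serre k G 2 -> serre2_on setT.
Proof.
rewrite /graph_serre edge_ideal_stanley_reisner => s2 A W1 W2 u v _ iA.
move=> /set0Pn[w1 w1W] /set0Pn[w2 w2W] eR W12 uR vR uv; apply: contraT => nGuv.
have icd := indep_downclosed; have SRi := stanley_reisner_ideal k icd.
have [P eP] := stanley_reisner_prime k A.
have memP f : f \in P <-> SR (powerset A) f by rewrite -eP.
have PX x : (X x \in P) = (x \notin A).
  by apply/idP/idP; rewrite memP Xv_stanley_reisner_powerset.
have Dd (W : {set V}) : downclosed [set F in IC | [disjoint F & W]].
  move=> B C BC; rewrite !inE => /andP[iC dC].
  by rewrite (independent_sub BC iC) (disjointWl BC dC).
(* Membership in [J1] means that every monomial with independent support meets W1; likewise [J2] and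
   W2. A monomial meeting both contains an edge, so the product of the two ideals lies in the edge
   ideal. *)
pose J1 := SR [set F in IC | [disjoint F & W1]].
pose J2 := SR [set F in IC | [disjoint F & W2]].
have J1i : ideal J1 by apply: stanley_reisner_ideal.
have J2i : ideal J2 by apply: stanley_reisner_ideal.
have notJ w (W : {set V}) : w \in residual setT A ->
    ~ ideal_loc P (SR IC) (to_loc P (X w)).
  rewrite inE => /andP[_ /andP[wA iwA]] /to_loc_mem_ideal_loc-/(_ SRi)[t tP].
  have [Q eQ] := stanley_reisner_prime k (w |: A).
  move=> h; have : t * X w \in Q.
    have : [set` Q]%classic (t * X w) => //; rewrite eQ; apply: stanley_reisner_sub h.
    by apply/subsetP => B; rewrite powersetE mem_indep => /independent_sub; apply.
  rewrite prime_idealrM => /orP[tQ|wQ].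
    have : [set` Q]%classic t by []. rewrite eQ => tQ'.
    case/negP: tP; apply/memP; apply: stanley_reisner_sub tQ'.
    by apply/subsetP => B; rewrite !powersetE => /subset_trans; apply; apply: subsetUr.
  have : [set` Q]%classic (X w) by []. rewrite eQ Xv_stanley_reisner_powerset.
  by rewrite setU11.
have Jw (W : {set V}) w : w \in W -> SR [set F in IC | [disjoint F & W]] (X w).
  move=> wW; apply: Xv_mem_stanley_reisner => //.
  by rewrite inE disjoints1 wW andbF.
have sub (W : {set V}) : (SR IC `<=` SR [set F in IC | [disjoint F & W]])%classic.
  by apply: stanley_reisner_sub; apply/subsetP => F; rewrite inE => /andP[].
(* Since u and v are not adjacent, A with u and v added is a face, which yields two strict
   inclusions of primes below P, hence dimension at least 2. *)
have : depth_ge (max_loc P) (ideal_loc P (SR IC)) 2.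
  apply: s2 => //; apply/dim_ge_loc => //.
  have [|||c [Dc cmon]] := @face_chain k V IC A (u |: (v |: A)) 2 icd.
  - rewrite mem_indep independentU1; move: vR; rewrite inE => /and3P[_ _ ->] /=.
    move: uR; rewrite inE independentU1 => /and3P[_ _ /andP[_ /forall_inP uA]].
    by apply/forall_inP => z /setU1P[->|/uA].
  - by rewrite setUA subsetUr.
  - apply: (@leq_trans #|[set u; v]|); first by rewrite cards2 uv.
    apply/subset_leq_card/subsetP => z; rewrite !inE => zuv.
    by move: uR vR; rewrite !inE => /and3P[_ uA _] /and3P[_ vA _];
      case/orP: zuv => /eqP->; rewrite ?uA ?vA ?eqxx ?orbT.
  exists c; split=> // i _; case: (Dc i) => ? h; split=> //.
  by rewrite eP.
have [mi Ji] := (ideal_loc_ideal P [set` P]%classic, ideal_loc_ideal P (SR IC)).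
case/(@not_depth_ge2 _ _ _ (ideal_loc P J1) (ideal_loc P J2)
  (to_loc P (X w1)) (to_loc P (X w2))) => //.
- exact: ideal_loc_ideal.
- exact: ideal_loc_ideal.
- exact: max_loc_proper.
- exact: max_loc_or_unit.
- move=> z /mem_ideal_loc[|a [t [tP aP ez]]]; first exact: prime_ideal.
  (* X_A is a unit at P, so z is a unit multiple of g = X_A a. A monomial of g with independent
     support contains A and, a being in P, a further vertex; that vertex is residual, so it lies in
     W1 or W2. The filter by [p] sorts the monomials accordingly. *)
  pose p (m : 'X_{1..#|V|}) :=
    ~~ [disjoint msupport m & W1] || (msupport m \notin IC).
  pose g := Xset k A * a.
  have AP : Xset k A \notin P by apply: Xset_notin => x xA; rewrite PX negbK.
  have [s es] := to_loc_unit (notin_primeM AP tP).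
  exists (s * to_loc P (mfilter p g)), (s * to_loc P (mfilter (predC p) g)).
  have [_ _ LM1] := ideal_loc_ideal P J1; have [_ _ LM2] := ideal_loc_ideal P J2.
  split.
  + apply: (LM1); apply: sub_ideal_loc => m; rewrite inE => /andP[mi' md].
    by rewrite mcoeff_mfilter /p md mi'.
  + apply: (LM2); apply: sub_ideal_loc => m; rewrite inE => /andP[mi' md].
    rewrite mcoeff_mfilter /= /p negb_or !negbK mi' andbT; case: ifP => // md1.
    apply: contraTeq md => gm; have Am := mcoeff_Xset_sub gm.
    have gP : g \in P by apply: idealMr.
    have /subsetPn[x xm xA] : ~~ (msupport m \subset A).
      by apply: contraNN gm => mA; move/memP: gP => ->; rewrite ?powersetE.
    have : x \in residual setT A.
      rewrite inE in_setT xA /=; rewrite mem_indep in mi'.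
      by apply: independent_sub mi'; rewrite subUset sub1set xm.
    rewrite -eR inE => /orP[xW|xW]; last first.
      by apply/pred0Pn; exists x; rewrite /= xm.
    suff : ~~ [disjoint msupport m & W1] by rewrite md1.
    by apply/pred0Pn; exists x; rewrite /= xm.
  + rewrite -mulrDr -to_locD -mfilter_split /g to_locM -ez.
    by rewrite [to_loc P _ * (_ * z)]mulrA -to_locM mulrA es mul1r.
- move=> z1 z2 /mem_ideal_loc-/(_ J1i)[a [s [sP Ja ea]]].
  move=> /mem_ideal_loc-/(_ J2i)[b [t [tP Jb eb]]].
  apply/mem_ideal_loc => //; exists (a * b), (s * t); split.
  + exact: notin_primeM.
  + move=> m mi'; apply/eqP; rewrite mcoeff_eq0; apply/negP.
    move=> /msuppM_le/allpairsP[[m1 m2] /= [m1a m2b em]].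
    have meet (W : {set V}) f m' : SR [set F in IC | [disjoint F & W]] f ->
        m' \in msupp f -> msupport m' \subset msupport m ->
        exists2 x, x \in msupport m & x \in W.
      move=> Jf; rewrite mcoeff_msupp => fm' sm'.
      have : ~~ [disjoint msupport m' & W].
        apply: contraNN fm' => dm'; rewrite Jf // inE dm' andbT.
        exact: indep_downclosed sm' mi'.
      case/pred0Pn => x /= /andP[xm' xW]; exists x => //.
      exact: (subsetP sm').
    have [|x xm xW] := meet _ _ _ Ja m1a; first by rewrite em msupportD subsetUl.
    have [|y ym yW] := meet _ _ _ Jb m2b; first by rewrite em msupportD subsetUr.
    rewrite mem_indep in mi'; move/independentP: mi' => /(_ x y xm ym).
    by rewrite W12.
  + by rewrite !to_locM mulrACA ea eb.
- by apply: ideal_loc_sub; apply: sub.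
- by apply: ideal_loc_sub; apply: sub.
- by apply: sub_ideal_loc; apply: Jw.
- by apply: (notJ _ W1); rewrite -eR inE w1W.
- by apply: sub_ideal_loc; apply: Jw.
- by apply: (notJ _ W1); rewrite -eR inE w2W orbT.
Qed.

End EdgeIdeal.

(** * Induced subgraphs *)

Section InducedComplexes.
Variables (V : finType) (G : sgraph V).
Local Notation IC := (indep_complex G).
Implicit Types (U A B F M W : {set V}) (u v w x z : V).

(** Subgraphs are given by vertex subsets of a fixed type, so that links and deletions stay of the
    same form and inductions need no change of type. *)
Definition induced_complex U : {set {set V}} := [set A in IC | A \subset U].
Local Notation ic := induced_complex.

Lemma mem_ic U A : (A \in ic U) = independent G A && (A \subset U).
Proof. by rewrite !inE. Qed.

Lemma icT : ic setT = IC.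
Proof. by apply/setP=> A; rewrite mem_ic subsetT andbT inE. Qed.

Lemma ic_downclosed U : downclosed (ic U).
Proof.
move=> A B AB; rewrite !mem_ic => /andP[iB BU].
by rewrite (independent_sub AB iB) (subset_trans AB BU).
Qed.

Lemma facet_icP U M : reflect
  [/\ M \subset U, independent G M &
      forall x, x \in U -> x \notin M -> ~~ independent G (x |: M)]
  (facet (ic U) M).
Proof.
apply: (iffP maxsetP) => [[]|[MU iM Mmax]].
  rewrite mem_ic => /andP[iM MU] Mmax; split=> // x xU; apply: contra => ixM.
  rewrite -(Mmax (x |: M)) ?setU11 ?subsetUr //.
  by rewrite mem_ic ixM subUset sub1set xU.
split=> [|B]; first by rewrite mem_ic iM.
rewrite mem_ic => /andP[iB BU] MB; apply/eqP; rewrite eqEsubset MB andbT.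
apply/subsetP => x xB; apply: contraT => /Mmax-/(_ (subsetP BU x xB))/negP[].
by apply: independent_sub iB; rewrite subUset sub1set xB.
Qed.

Lemma mem_residual U A u : independent G A ->
  (u \in residual G U A) = [&& u \in U, u \notin A & [forall a in A, ~~ G u a]].
Proof. by move=> iA; rewrite inE independentU1 iA. Qed.

Lemma mem_residual1 U x u :
  (u \in residual G U [set x]) = [&& u \in U, u != x & ~~ G x u].
Proof.
rewrite mem_residual ?independent_set1 // inE adj_sym; congr [&& _, _ & _].
apply/forall_inP/idP => [->//|xu a]; first by rewrite inE.
by rewrite inE => /eqP->.
Qed.

Lemma independent_set2 u v : independent G [set u; v] = ~~ G u v.
Proof.
rewrite independentU1 independent_set1 /=; apply/forall_inP/idP => [|uv z].
  by apply; rewrite inE.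
by rewrite inE => /eqP->.
Qed.

Lemma residual0 U : residual G U set0 = U.
Proof. by apply/setP=> u; rewrite inE in_set0 setU0 independent_set1 /= andbT. Qed.

Lemma ic_link U x : x \in U -> link (ic U) x = ic (residual G U [set x]).
Proof.
move=> xU; apply/setP=> F; rewrite inE !mem_ic independentU1 subUset sub1set xU /=.
apply/and3P/andP => [[xF /andP[iF /forall_inP xnF] FU]|[iF /subsetP FR]].
  split=> //; apply/subsetP => u uF; rewrite mem_residual1 (subsetP FU) // xnF //.
  by rewrite andbT; apply: contraNneq xF => <-.
split.
- by apply/negP => /FR; rewrite mem_residual1 eqxx andbF.
- by rewrite iF; apply/forall_inP => u /FR; rewrite mem_residual1 => /and3P[].
- by apply/subsetP => u /FR; rewrite mem_residual1 => /and3P[].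
Qed.

Lemma ic_del U x : del (ic U) x = ic (U :\ x).
Proof. by apply/setP=> F; rewrite inE !mem_ic subsetD1 andbA. Qed.

Lemma ic_simplex U : independent G U -> ic U = powerset U.
Proof.
move=> iU; apply/setP=> A; rewrite mem_ic powersetE.
by apply/andP/idP => [[]//|AU]; rewrite AU (independent_sub AU iU).
Qed.

Lemma set1_ic U x : ([set x] \in ic U) = (x \in U).
Proof. by rewrite mem_ic independent_set1 sub1set. Qed.

Definition sheds U x : Prop :=
  forall F, facet (ic (U :\ x)) F -> ~~ independent G (x |: F).

Lemma shedsP U x : x \in U ->
  sheds U x <-> forall F, facet (del (ic U) x) F -> facet (ic U) F.
Proof.
move=> xU; rewrite ic_del; split=> sh F fF; have /facet_icP[FU iF Fmax] := fF.
  apply/facet_icP; split=> // [|y yU yF].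
    exact: subset_trans FU (subD1set _ _).
  have [->|yx] := eqVneq y x; first exact: sh.
  by apply: Fmax => //; rewrite !inE yx.
have /facet_icP[_ _] := sh F fF; apply=> //.
by apply/negP => /(subsetP FU); rewrite !inE eqxx.
Qed.

Lemma vd_simplex U : independent G U -> vertex_decomposable (ic U).
Proof. by move=> iU; apply: (@VDsimplex _ _ U); apply: ic_simplex. Qed.

Lemma vd_shed U x : x \in U -> vertex_decomposable (ic (residual G U [set x])) ->
  vertex_decomposable (ic (U :\ x)) -> sheds U x -> vertex_decomposable (ic U).
Proof.
move=> xU vl vd sh; apply: (@VDshed _ _ x).
- by rewrite set1_ic.
- by rewrite ic_link.
- by rewrite ic_del.
- exact/(shedsP xU).
Qed.

(** Induction on vertex sets instead of complexes. The constructor for the empty complex cannot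
    occur, since [set0] is always independent. *)
Lemma vd_ind (P : {set V} -> Prop) :
  (forall U, independent G U -> P U) ->
  (forall U x, x \in U -> P (residual G U [set x]) -> P (U :\ x) ->
    sheds U x -> P U) ->
  forall U, vertex_decomposable (ic U) -> P U.
Proof.
move=> Ps Psh U; move eD : (ic U) => D vD.
elim: vD U eD => {D}[D F ->|D ->|D x xD _ IHl _ IHd sh] U eD.
- apply: Ps; have : F \in ic U by rewrite eD powersetE.
  rewrite mem_ic => /andP[iF _]; apply: independent_sub iF; apply/subsetP => u.
  by rewrite -set1_ic eD powersetE sub1set.
- have : set0 \in ic U by rewrite mem_ic independent_set0 sub0set.
  by rewrite eD inE.
- rewrite -eD set1_ic in xD; apply: (Psh _ x) => //.
  + by apply: IHl; rewrite -eD ic_link.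
  + by apply: IHd; rewrite -eD ic_del.
  + by apply/shedsP => //; rewrite eD.
Qed.

(** A decomposition of U also decomposes the cone: every facet of a cone contains the apex z, and
    removing z reduces the shedding condition to the one for U. *)
Lemma vd_cone U z : z \notin U -> (forall u, u \in U -> ~~ G z u) ->
  vertex_decomposable (ic U) -> vertex_decomposable (ic (z |: U)).
Proof.
move=> zU zG vU; elim/vd_ind: vU zU zG => {}U => [iU|x xU IHl IHd sh] zU zG.
  by apply: vd_simplex; rewrite independentU1 iU; apply/forall_inP.
have zx : z != x by apply: contraNneq zU => ->.
have eD : (z |: U) :\ x = z |: U :\ x.
  by apply/setP=> y; rewrite !inE; case: (eqVneq y z) => [->|]; rewrite ?zx.
apply: (@vd_shed _ x); first by rewrite inE xU orbT.
- rewrite (_ : residual _ _ _ = z |: residual G U [set x]).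
    apply: IHl => [|u]; first by rewrite mem_residual1 (negPf zU).
    by rewrite mem_residual1 => /andP[/zG].
  apply/setP=> y; rewrite mem_residual1 !in_setU1 mem_residual1.
  by have [->|] := eqVneq y z; rewrite //= zx adj_sym zG.
- rewrite eD; apply: IHd => [|u]; first by rewrite !inE (negPf zU) andbF.
  by rewrite inE => /andP[_ /zG].
move=> F; rewrite eD => /facet_icP[FU iF Fmax].
have zF : z \in F.
  apply: contraT => zF; case/negP: (Fmax z (setU11 _ _) zF).
  rewrite independentU1 iF; apply/forall_inP => u uF.
  by have /setU1P[->|] := subsetP FU u uF; rewrite ?adj_irr // inE => /andP[_ /zG].
have : facet (ic (U :\ x)) (F :\ z).
  apply/facet_icP; split; first by rewrite subDset.
    by apply: independent_sub iF; apply: subD1set.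
  move=> y yU yF; have yz : y != z.
    by apply: contraNneq zU => <-; move: yU; rewrite inE => /andP[].
  have := Fmax y; rewrite inE yU orbT => /(_ isT); rewrite !inE yz /= in yF *.
  move=> /(_ yF); apply: contra; rewrite !independentU1 iF => /andP[_ /forall_inP h].
  apply/forall_inP => u uF; have [->|uz] := eqVneq u z; last by apply: h; rewrite !inE uz.
  by rewrite adj_sym zG //; move: yU; rewrite inE => /andP[].
move/sh; apply: contra; apply: independent_sub; apply: setUS; apply: subD1set.
Qed.

(** The complex is a set of points: any point can be shed as long as another one remains. *)
Lemma vd_clique U : (forall u v, u \in U -> v \in U -> u != v -> G u v) ->
  vertex_decomposable (ic U).
Proof.
have [n] := ubnP #|U|; elim: n U => // n IH U lt_U clU.
have [->|/set0Pn[x xU]] := eqVneq U set0; first exact/vd_simplex/independent_set0.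
have [eU|/set0Pn[y]] := eqVneq (U :\ x) set0.
  by apply: vd_simplex; rewrite -(setD1K xU) eU setU0 independent_set1.
move=> yUx; apply: (vd_shed xU).
- rewrite (_ : residual _ _ _ = set0); first exact/vd_simplex/independent_set0.
  apply/setP=> u; rewrite mem_residual1 inE; apply/negP => /and3P[uU ux].
  by rewrite clU // eq_sym.
- apply: IH; first by move: lt_U; rewrite (cardsD1 x) xU.
  by move=> u v /setD1P[_ uU] /setD1P[_ vU]; apply: clU.
move=> F /facet_icP[FU iF Fmax]; have [F0|/set0Pn[u uF]] := eqVneq F set0.
  have := Fmax y yUx; rewrite F0 inE setU0 independent_set1.
  by move=> /(_ isT).
have /setD1P[ux uU] := subsetP FU u uF.
rewrite independentU1 iF /=; apply/forall_inPn; exists u => //.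
by rewrite negbK clU // eq_sym.
Qed.

(** * Combinatorial consequences of (S_2) *)

Lemma serre2_residual U A : serre2_on G U -> A \subset U -> independent G A ->
  serre2_on G (residual G U A).
Proof.
move=> sU AU iA B W1 W2 u v BR iB W10 W20 eW W12.
have RU : residual G U A \subset U.
  by apply/subsetP => y; rewrite inE => /andP[].
have BA a b : a \in A -> b \in B -> ~~ G b a.
  move=> aA /(subsetP BR); rewrite mem_residual // => /and3P[_ _ /forall_inP].
  exact.
have iAB : independent G (A :|: B).
  apply/independentP => a b /setUP[aA|aB] /setUP[bA|bB].
  - exact: (independentP _ _ iA).
  - by rewrite adj_sym; apply: BA.
  - exact: BA.
  - exact: (independentP _ _ iB).
have eR : residual G (residual G U A) B = residual G U (A :|: B).
  apply/setP=> y; rewrite mem_residual // !(mem_residual _ _ iA) (mem_residual _ _ iAB).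
  rewrite inE negb_or -!andbA; congr (_ && _).
  apply/and4P/and3P => [[yA /forall_inP ynA yB /forall_inP ynB]|].
    split=> //; apply/forall_inP => a /setUP[]; [exact: ynA|exact: ynB].
  move=> [yA yB /forall_inP yn]; split=> //; apply/forall_inP => a aX.
    by apply: yn; rewrite inE aX.
  by apply: yn; rewrite inE aX orbT.
rewrite !eR in eW * => uR vR uv; apply: (sU (A :|: B) W1 W2) => //.
by rewrite subUset AU (subset_trans BR RU).
Qed.

Lemma facet_link D M u : downclosed D -> facet D M -> u \in M ->
  facet (link D u) (M :\ u).
Proof.
move=> Dd /maxsetP[MD Mmax] uM; apply/maxsetP; rewrite inE setD11 setD1K //.
split=> // B; rewrite inE => /andP[uB uBD] MB.
have /Mmax <- // : M \subset u |: B by rewrite -(setD1K uM) setUS.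
by rewrite setU1K.
Qed.

(** By induction on links, facets sharing a vertex have equal size. Let W be the vertices all of
    whose facets have size |M|. If W is not U, each vertex of W is adjacent to each vertex outside,
    since a common facet would transfer the size; (S_2) then makes U a clique, and all facets are
    points. *)
Lemma serre2_pure U M M' : serre2_on G U ->
  facet (ic U) M -> facet (ic U) M' -> #|M| = #|M'|.
Proof.
have [n] := ubnP #|U|; elim: n U M M' => // n IH U M M' lt_U sU fM fM'.
have same A B w : facet (ic U) A -> facet (ic U) B -> w \in A -> w \in B ->
    #|A| = #|B|.
  move=> fA fB wA wB; rewrite (cardsD1 w A) (cardsD1 w B) wA wB; congr _.+1.
  have wU : w \in U by have /facet_icP[/subsetP AU _ _] := fA; apply: AU.
  have icd := @ic_downclosed U.
  have := facet_link icd fA wA; have := facet_link icd fB wB.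
  rewrite ic_link // => fB' fA'; apply: IH fA' fB'.
    rewrite -ltnS; apply: leq_trans lt_U; rewrite ltnS.
    apply: proper_card; apply/properP; split.
      by apply/subsetP => y; rewrite mem_residual1 => /andP[].
    by exists w => //; rewrite mem_residual1 eqxx andbF.
  by apply: serre2_residual; rewrite ?sub1set ?independent_set1.
pose W := [set w in U | [forall F, facet (ic U) F ==> (w \in F) ==> (#|F| == #|M|)]].
have WP w : reflect (w \in U /\ forall F, facet (ic U) F -> w \in F -> #|F| = #|M|)
    (w \in W).
  rewrite inE; apply: (iffP andP) => -[wU h]; split=> //.
    by move=> F fF wF; have := forallP h F; rewrite fF wF => /eqP.
  by apply/forallP => F; apply/implyP => fF; apply/implyP => wF; apply/eqP/h.
have /facet_icP[MU iM Mmax] := fM; have /facet_icP[MU' iM' Mmax'] := fM'.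
have [M0|/set0Pn[w wM]] := eqVneq M set0.
  have U0 : U = set0.
    apply/eqP; rewrite -subset0; apply/subsetP => y yU.
    have := Mmax y yU; rewrite M0 inE setU0 independent_set1.
    by move=> /(_ isT).
  by move: MU'; rewrite M0 U0 subset0 => /eqP->.
have wW : w \in W.
  by apply/WP; split=> [|F fF wF]; [exact: (subsetP MU)|apply: same wF wM].
have [UW|/subsetPn[v vU vW]] := boolP (U \subset W).
  have [M0|/set0Pn[w' wM']] := eqVneq M' set0.
    have := Mmax' w (subsetP MU w wM); rewrite M0 inE setU0 independent_set1.
    by move=> /(_ isT).
  by have /WP[_ /(_ _ fM' wM')] := subsetP UW _ (subsetP MU' _ wM').
have clU a b : a \in U -> b \in U -> a != b -> G a b.
  have := sU set0 W (U :\: W) a b; rewrite residual0 sub0set independent_set0.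
  move=> h aU bU ab; apply: h => //.
  - by apply/set0Pn; exists w.
  - by apply/set0Pn; exists v; rewrite inE vW.
  - apply/setP=> y; rewrite in_setU in_setD; case: (boolP (y \in W)) => //.
    by case/WP => ->.
  move=> x y /WP[xU xW] /setDP[yU]; apply: contraR => nxy.
  have ixy : [set x; y] \in ic U.
    by rewrite mem_ic independent_set2 nxy subUset !sub1set xU yU.
  have [F fF xyF] := facet_ext ixy.
  have [xF yF] : x \in F /\ y \in F.
    by split; apply: (subsetP xyF); rewrite !inE eqxx ?orbT.
  by apply/WP; split=> // F' fF' yF'; rewrite -(xW F fF xF); apply: same yF' yF.
have card1 F : F \subset U -> independent G F -> #|F| <= 1.
  move=> FU iF; rewrite leqNgt; apply/negP => /card_gt1P[a [b [aF bF ab]]].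
  have := independentP _ _ iF a b aF bF.
  by rewrite clU // (subsetP FU).
have [M0'|/set0Pn[w' wM']] := eqVneq M' set0.
  have := Mmax' w (subsetP MU w wM); rewrite M0' inE setU0 independent_set1.
  by move=> /(_ isT).
apply: (@etrans _ _ 1).
  by apply/eqP; rewrite eqn_leq card1 // card_gt0; apply/set0Pn; exists w.
apply/esym/eqP; rewrite eqn_leq card1 // card_gt0; apply/set0Pn; by exists w'.
Qed.

(* The complement of U being connected, W can be enlarged one vertex at a time. *)
Lemma vd_grow U W : serre2_on G U ->
  (forall A, A \subset U -> independent G A -> #|A| <= 2) ->
  W \subset U -> W != set0 -> vertex_decomposable (ic W) ->
  (forall w, w \in W -> exists w', [/\ w' \in W, w != w' & ~~ G w w']) ->
  vertex_decomposable (ic U).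
Proof.
move=> sU alpha2; have [n] := ubnP #|U :\: W|.
elim: n W => // n IH W lt_n WU W0 vW nonadj.
have [UW|/subsetPn[v vU vNW]] := boolP (U \subset W).
  by rewrite (_ : U = W) //; apply/eqP; rewrite eqEsubset UW.
have no3 a b c : a \in U -> b \in U -> c \in U -> a != b -> a != c -> b != c ->
    ~~ G a b -> ~~ G a c -> G b c.
  move=> aU bU cU ab ac bc nab nac; apply: contraT => nbc.
  have := alpha2 (a |: [set b; c]).
  rewrite !subUset !sub1set aU bU cU cardsU1 cards2 !inE negb_or ab ac bc /=.
  rewrite independentU1 independent_set2 nbc /= => /(_ isT); apply.
  by apply/forall_inP => z; rewrite !inE => /orP[]/eqP->.
(* Otherwise W is completely joined to the rest of U, and (S_2) would make U a clique, against the
   nonadjacent pairs in W. *)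
have [a [b [aW bU bW nab]]] :
    exists a b, [/\ a \in W, b \in U, b \notin W & ~~ G a b].
  apply: contrapT => joined; have /set0Pn[w wW] := W0.
  have [w' [w'W ww' /negP[]]] := nonadj w wW.
  apply: (sU set0 W (U :\: W)) => //; rewrite ?residual0 ?sub0set //.
  - exact: independent_set0.
  - by apply/set0Pn; exists v; rewrite inE vNW.
  - apply/setP=> y; rewrite in_setU in_setD; case: (boolP (y \in W)) => //.
    by move/(subsetP WU) ->.
  - move=> x y xW /setDP[yU yW]; apply: contraT => nxy.
    by case: joined; exists x, y.
  - exact: (subsetP WU).
  - exact: (subsetP WU).
have bWD : (b |: W) :\ b = W by rewrite setU1K.
apply: (IH (b |: W)).
- rewrite -ltnS; apply: leq_trans lt_n; rewrite ltnS setUC -setDDl.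
  apply: proper_card; apply/properP; split.
    exact: subD1set.
  by exists b; rewrite !inE ?eqxx ?bW.
- by rewrite subUset sub1set bU.
- by apply/set0Pn; exists b; rewrite setU11.
(* The new vertex b is shed. Two nonadjacent vertices in its link would form with b an independent
   set of size 3, so the link is a clique. *)
- apply: (@vd_shed _ b); rewrite ?setU11 ?bWD //.
    apply: vd_clique => x y; rewrite !mem_residual1 => /and3P[xbW xb nbx].
    move=> /and3P[ybW yb nby] xy.
    have xU : x \in U by case/setU1P: xbW => [->|/(subsetP WU)].
    have yU : y \in U by case/setU1P: ybW => [->|/(subsetP WU)].
    by apply: (no3 b) => //; rewrite eq_sym.
  move=> F; rewrite bWD => /facet_icP[FW iF Fmax].
  have bF : b \notin F by apply: contra bW; apply: (subsetP FW).
  (* A facet of W has two vertices, because each vertex of W has a nonneighbour in W; adding b would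
     again exceed size 2. *)
  suff [f [g [fF gF fg]]] : exists f g, [/\ f \in F, g \in F & f != g].
    apply/negP => ibF; have := alpha2 (b |: F); rewrite ibF subUset sub1set bU.
    rewrite (subset_trans FW WU) cardsU1 bF (cardsD1 f) fF (cardsD1 g).
    by rewrite !inE eq_sym fg gF => /(_ isT isT).
  have /set0Pn[w wW] := W0; have [F0|/set0Pn[f fF]] := eqVneq F set0.
    have := Fmax w wW; rewrite F0 inE setU0 independent_set1.
    by move=> /(_ isT).
  have [g [gW fg nfg]] := nonadj f (subsetP FW f fF).
  have [gF|gF] := boolP (g \in F); first by exists f, g.
  have := Fmax g gW gF; rewrite independentU1 iF => /forall_inPn[h hF ngh].
  exists f, h; split=> //; apply: contraNneq ngh => <-.
  by rewrite adj_sym.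
- move=> w /setU1P[->|wW].
    exists a; rewrite inE aW orbT adj_sym nab; split=> //.
    by apply: contraNneq bW => ->.
  by have [w' [w'W ww' nww']] := nonadj w wW; exists w'; rewrite inE w'W orbT.
Qed.

(** A facet M of size at least 3 leaves a set B of at most 2 vertices. If u in B had two neighbours
    in M, a facet N through u, of size |M| by purity, would miss both, hence contain all of B; as
    every vertex of M has a neighbour in B, N would be B itself, too small. So choosing neighbours
    maps M injectively into B, which is impossible. *)
Lemma serre2_small_alpha U : serre2_on G U -> #|U| <= 5 ->
  (forall z, z \in U -> exists2 u, u \in U & G z u) ->
  forall A, A \subset U -> independent G A -> #|A| <= 2.
Proof.
move=> sU U5 noiso A AU iA; have : A \in ic U by rewrite mem_ic iA.
case/facet_ext => M fM /subset_leq_card AM; apply: leq_trans AM _.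
rewrite leqNgt; apply/negP => M3; have /facet_icP[MU iM Mmax] := fM.
have B2 : #|U :\: M| <= 2.
  by rewrite cardsD (setIidPr MU); move: U5 M3; clear; lia.
have uniq_nbr u m m' : u \in U :\: M -> m \in M -> m' \in M -> G u m -> G u m' ->
    m = m'.
  move=> uB mM m'M um um'; apply/eqP; apply: contraT => mm'.
  have uU : u \in U by case/setDP: uB.
  have : [set u] \in ic U by rewrite set1_ic.
  case/facet_ext => N fN; rewrite sub1set => uN; have /facet_icP[NU iN _] := fN.
  have NM := serre2_pure sU fN fM.
  have notN x : G u x -> x \notin N.
    by apply: contraTN => xN; apply: (independentP _ _ iN).
  have cN : #|N| = #|N :&: M| + #|N :\: M| by rewrite cardsID.
  have NB : N :\: M \subset U :\: M by apply: setSD.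
  have cNM : #|N :&: M| + 2 <= #|M|.
    have -> : #|M| = #|M :\ m :\ m'| + 2.
      rewrite (cardsD1 m M) mM (cardsD1 m' (M :\ m)) !inE eq_sym mm' m'M.
      by rewrite addnA addnC.
    rewrite leq_add2r; apply: subset_leq_card.
    apply/subsetP => y /setIP[yN yM]; rewrite !inE yM andbT.
    by apply/andP; split; apply: contraTneq yN => ->; apply: notN.
  have eB : N :\: M = U :\: M.
    by apply/eqP; rewrite eqEcard NB; move: cN cNM NM B2; clear; lia.
  have NM0 : N :&: M = set0.
    apply/setP=> y; rewrite inE in_set0; apply/negP => /andP[yN yM].
    have [z zU yz] := noiso y (subsetP MU y yM).
    have zM : z \notin M.
      by apply: contraL yz => zM; apply: (independentP _ _ iM).
    have : z \in N :\: M by rewrite eB inE zM.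
    case/setDP => zN _; have := independentP _ _ iN y z yN zN.
    by rewrite yz.
  by move: cN M3 NM B2; rewrite NM0 cards0 eB; clear; lia.
have /choice[f Hf] : forall m, exists u, m \in M -> u \in U :\: M /\ G u m.
  move=> m; have [mM|] := boolP (m \in M); last by exists m.
  have [u uU mu] := noiso m (subsetP MU m mM); exists u => _.
  rewrite adj_sym mu inE uU andbT; split=> //.
  by apply: contraL mu => uM; apply: (independentP _ _ iM).
have : #|f @: M| = #|M|.
  apply: card_in_imset => m m' mM m'M eqf.
  have [fB fm] := Hf m mM; have [_ fm'] := Hf m' m'M.
  by apply: (uniq_nbr (f m)) => //; rewrite eqf.
have : f @: M \subset U :\: M by apply/subsetP => _ /imsetP[m /Hf[? _] ->].
move/subset_leq_card; move: B2 M3; clear; lia.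
Qed.

(** Isolated vertices are cone points and are split off first. After that independent sets have at
    most 2 vertices: U is a clique, or it is grown from a nonadjacent pair by [vd_grow]. *)
Lemma serre2_small_vd U : serre2_on G U -> #|U| <= 5 -> vertex_decomposable (ic U).
Proof.
have [n] := ubnP #|U|; elim: n U => // n IH U lt_n sU U5.
have [iso|noiso] := boolP [exists z in U, [forall u in U, ~~ G z u]].
  have /exists_inP[z zU /forall_inP zG] := iso.
  have eR : residual G U [set z] = U :\ z.
    apply/setP=> u; rewrite mem_residual1 !inE andbC.
    by case: (boolP (u \in U)) => [/zG ->|]; rewrite ?andbT ?andbF.
  have cU : #|U| = #|U :\ z|.+1 by rewrite (cardsD1 z) zU.
  rewrite -(setD1K zU); apply: vd_cone; first by rewrite !inE eqxx.
    by move=> u /setD1P[_ /zG].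
  apply: IH; rewrite ?cU // in lt_n U5 *; last exact: ltnW.
  by rewrite -eR; apply: serre2_residual; rewrite ?sub1set ?independent_set1.
have {}noiso z : z \in U -> exists2 u, u \in U & G z u.
  move=> zU; move: noiso; rewrite negb_exists_in => /forall_inP/(_ z zU).
  by case/forall_inPn => u uU; rewrite negbK; exists u.
have alpha2 := serre2_small_alpha sU U5 noiso.
have [/existsP[u /existsP[v]]|clU] :=
    boolP [exists u, exists v, [&& u \in U, v \in U, u != v & ~~ G u v]].
  move=> /and4P[uU vU uv nuv]; apply: (vd_grow (W := [set u; v])) => //.
  - by rewrite subUset !sub1set uU.
  - by apply/set0Pn; exists u; rewrite !inE eqxx.
  - by apply: vd_simplex; rewrite independent_set2.
  - move=> w; rewrite !inE => /orP[]/eqP->; [exists v|exists u];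
      by rewrite !inE eqxx ?orbT // [v == u]eq_sym adj_sym.
apply: vd_clique => u v uU vU uv; apply: contraNT clU => nuv.
by apply/existsP; exists u; apply/existsP; exists v; rewrite uU vU uv.
Qed.

End InducedComplexes.

(** * Rooted products *)

Section Embedding.
Variables (V1 V2 : finType) (G1 : sgraph V1) (G2 : sgraph V2) (f : V1 -> V2).
Hypothesis f_inj : injective f.
Hypothesis f_adj : forall a b, G2 (f a) (f b) = G1 a b.
Implicit Types (A U W : {set V1}) (F Z : {set V2}).
Local Notation ic1 := (induced_complex G1).
Local Notation ic2 := (induced_complex G2).

Lemma independent_imset A : independent G2 (f @: A) = independent G1 A.
Proof.
apply/independentP/independentP => iA a b.
  by move=> aA bA; rewrite -f_adj; apply: iA; apply: imset_f.
by move=> /imsetP[a' aA ->] /imsetP[b' bA ->]; rewrite f_adj; apply: iA.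
Qed.

Lemma independent_preimset F : independent G2 F -> independent G1 (f @^-1: F).
Proof.
move=> /independentP iF; apply/independentP => a b; rewrite !inE -f_adj.
exact: iF.
Qed.

Lemma residual_imset U A : residual G2 (f @: U) (f @: A) = f @: residual G1 U A.
Proof.
apply/setP=> y; apply/idP/imsetP => [|[u]]; rewrite inE.
  move=> /andP[/imsetP[u uU ->]]; rewrite (mem_imset _ _ f_inj).
  rewrite -imsetU1 independent_imset => uA.
  by exists u => //; rewrite inE uU.
move=> /andP[uU uA ->]; rewrite inE !(mem_imset _ _ f_inj) -imsetU1.
by rewrite independent_imset uU.
Qed.

Lemma serre2_imset U : serre2_on G2 (f @: U) -> serre2_on G1 U.
Proof.
move=> sU A W1 W2 u v AU iA W10 W20 eW W12 uR vR uv; rewrite -f_adj.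
apply: (sU (f @: A) (f @: W1) (f @: W2)).
- exact: imsetS.
- by rewrite independent_imset.
- by rewrite imset_eq0.
- by rewrite imset_eq0.
- by rewrite -imsetU eW residual_imset.
- by move=> _ _ /imsetP[a aW ->] /imsetP[b bW ->]; rewrite f_adj; apply: W12.
- by rewrite residual_imset; apply: imset_f.
- by rewrite residual_imset; apply: imset_f.
- by rewrite (inj_eq f_inj).
Qed.

Lemma facet_imset U A : facet (ic1 U) A -> facet (ic2 (f @: U)) (f @: A).
Proof.
move=> /facet_icP[AU iA Amax]; apply/facet_icP; split.
- exact: imsetS.
- by rewrite independent_imset.
- move=> _ /imsetP[u uU ->]; rewrite (mem_imset _ _ f_inj) -imsetU1.
  by rewrite independent_imset; apply: Amax.
Qed.

(** The complex is the join of those of W and Z. A decomposition of W is carried out first; when W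
    has become a simplex, its vertices are cone points over Z. *)
Lemma vd_disjoint_union W Z : vertex_decomposable (ic1 W) ->
  vertex_decomposable (ic2 Z) ->
  (forall a, a \in W -> f a \notin Z) ->
  (forall a b, a \in W -> b \in Z -> ~~ G2 (f a) b) ->
  vertex_decomposable (ic2 (f @: W :|: Z)).
Proof.
move=> vW vZ; elim/vd_ind: vW => [{}W iW|{}W w wW IHl IHd sh] disj nadj.
  have [n] := ubnP #|W|; elim: n W iW disj nadj => // n IH W iW disj nadj lt_n.
  have [->|/set0Pn[w wW]] := eqVneq W set0; first by rewrite imset0 set0U.
  rewrite -(setD1K wW) imsetU1 -setUA; apply: vd_cone.
  - rewrite inE (mem_imset _ _ f_inj) !inE eqxx /=; exact: disj.
  - move=> u /setUP[/imsetP[a /setD1P[_ aW] ->]|uU]; last exact: nadj.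
    by rewrite f_adj; apply: (independentP _ _ iW).
  - apply: IH.
    + exact: independent_sub (subD1set _ _) iW.
    + by move=> a /setD1P[_ /disj].
    + by move=> a b /setD1P[_ aW]; apply: nadj.
    + by move: lt_n; rewrite (cardsD1 w) wW.
have eD : (f @: W :|: Z) :\ f w = f @: (W :\ w) :|: Z.
  rewrite setDUl (_ : Z :\ f w = Z); last first.
    by apply/setDidPl; rewrite disjoint_sym disjoints1 disj.
  congr (_ :|: _); apply/setP=> y; rewrite !inE; apply/andP/imsetP.
    move=> [yw /imsetP[a aW ey]]; exists a => //; rewrite !inE aW andbT.
    by apply: contraNneq yw => <-; rewrite ey.
  move=> [a /setD1P[aw aW] ->]; rewrite (inj_eq f_inj) aw; split=> //.
  exact: imset_f.
apply: (@vd_shed _ _ _ (f w)).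
- by rewrite inE imset_f.
- rewrite (_ : residual _ _ _ = f @: residual G1 W [set w] :|: Z).
    apply: IHl => [a|a b]; rewrite mem_residual1 => /and3P[aW _ _]; first exact: disj.
    exact: nadj.
  apply/setP=> y; rewrite mem_residual1 !in_setU.
  have [yZ|yZ] := boolP (y \in Z).
    by rewrite !orbT /= nadj // andbT; apply: contraTneq yZ => ->; apply: disj.
  rewrite !orbF; apply/and3P/imsetP => [[/imsetP[a aW ->]]|[a]].
    rewrite (inj_eq f_inj) f_adj => aw wa; exists a => //.
    by rewrite mem_residual1 aW aw.
  rewrite mem_residual1 => /and3P[aW aw wa] ->.
  by rewrite (inj_eq f_inj) f_adj imset_f.
- rewrite eD; apply: IHd => [a /setD1P[_ /disj]//|a b /setD1P[_ aW]].
  exact: nadj.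
move=> F; rewrite eD => /facet_icP[FU iF Fmax].
have memF a : f a \in F -> a \in W -> a \in W :\ w.
  move=> aF aW; have /setUP[|aZ] := subsetP FU _ aF.
    by rewrite (mem_imset _ _ f_inj).
  by have := disj a aW; rewrite aZ.
have : facet (ic1 (W :\ w)) (f @^-1: F :&: W).
  apply/facet_icP; split.
  - by apply/subsetP => a; rewrite !inE => /andP[/memF]; rewrite !inE.
  - by apply: independent_sub (independent_preimset iF); apply: subsetIl.
  - move=> a aWw aF; have /setD1P[aw aW] := aWw.
    have faF : f a \notin F by apply: contra aF; rewrite !inE aW andbT.
    have := Fmax (f a); rewrite inE imset_f // => /(_ isT faF).
    apply: contra; rewrite !independentU1 iF => /andP[_ /forall_inP h].
    apply/forall_inP => y yF; have /setUP[/imsetP[b]|yZ] := subsetP FU y yF.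
      move=> /setD1P[_ bW] ey; rewrite ey f_adj; apply: h.
      by rewrite !inE bW -ey yF.
    exact: nadj.
move/sh; apply: contra => i2; apply: independent_sub (independent_preimset i2).
apply/subsetP => a; rewrite !inE => /predU1P[->|/andP[aF _]]; rewrite ?eqxx //.
by rewrite aF orbT.
Qed.

End Embedding.

Lemma graph_pure_del_vertex (V : finType) (G : sgraph V) (x : V) :
  serre2_on G (setT :\ x) -> graph_pure (del_vertex G x).
Proof.
move=> s F F' fF fF'.
have inj : injective (val : {v : V | v != x} -> V) := val_inj.
rewrite -(card_imset (mem F) inj) -(card_imset (mem F') inj).
have img : [set val v | v in [set: {v : V | v != x}]] = setT :\ x.
  apply/setP=> v; rewrite !inE andbT; apply/imsetP/idP => [[w _ ->]|vx].
    exact: (valP w).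
  by exists (Sub v vx); rewrite ?inE ?SubK.
have up E : facet (indep_complex (del_vertex G x)) E ->
    facet (induced_complex G (setT :\ x)) (val @: E).
  rewrite -img -icT; apply: (facet_imset (G1 := del_vertex G x) inj).
  by [].
exact: serre2_pure s (up _ fF) (up _ fF').
Qed.

Section RootedProductComplexes.
Variables (m : nat) (V : 'I_m -> finType).
Variables (H : forall i, sgraph (V i)) (x : forall i, V i).
Local Notation T := {i : 'I_m & V i}.
Local Notation tg i := (@Tagged _ i V).
Implicit Types (K : sgraph 'I_m) (U : forall i, {set V i}) (A F : {set T}).

Lemma rooted_adj_same K i (u v : V i) :
  rooted_product K H x (tg i u) (tg i v) = H i u v.
Proof. by rewrite /= /rooted_adj /= eqxx tagged_asE adj_irr !andbF orbF. Qed.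

Lemma rooted_adj_diff K i j (u : V i) (v : V j) : i != j ->
  rooted_product K H x (tg i u) (tg j v) = [&& u == x i, v == x j & K i j].
Proof. by move=> /negPf ij; rewrite /= /rooted_adj /= ij. Qed.

Lemma Tagged_inj i : injective (tg i).
Proof. by move=> u v /eqP; rewrite eq_Tagged => /eqP. Qed.

Definition component A i : {set V i} := tg i @^-1: A.

Definition assemble U : {set T} := [set u | tagged u \in U (tag u)].

Lemma mem_assemble U i (v : V i) : (tg i v \in assemble U) = (v \in U i).
Proof. by rewrite inE. Qed.

Lemma mem_component A i (v : V i) : (v \in component A i) = (tg i v \in A).
Proof. by rewrite inE. Qed.

Lemma card_component A : #|A| = \sum_i #|component A i|.
Proof.
rewrite -sum1_card (eq_bigr (fun i => \sum_(v : V i | tg i v \in A) 1)); last first.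
  by move=> i _; rewrite -sum1_card; apply: eq_bigl => v; rewrite inE.
rewrite (sig_big_dep _ (fun i v => tg i v \in A) (fun _ _ => 1)) /=.
by apply: eq_bigl => -[i v].
Qed.

Lemma rooted_independentP K A : reflect
  ((forall i, independent (H i) (component A i)) /\
   (forall i j, K i j -> tg i (x i) \in A -> tg j (x j) \notin A))
  (independent (rooted_product K H x) A).
Proof.
apply: (iffP (independentP _ _)) => [iA|[iA cA] [i u] [j v] uA vA].
  split=> [i|i j Gij xi].
    apply/independentP => u v; rewrite !inE -(rooted_adj_same K); exact: iA.
  apply/negP => /(iA _ _ xi); rewrite rooted_adj_diff ?eqxx ?Gij //.
  by apply: contraTneq Gij => ->; rewrite adj_irr.
have [eij|ij] := eqVneq i j.
  move: eij v vA => <- v vA; rewrite rooted_adj_same.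
  by apply: (independentP _ _ (iA i)); rewrite inE.
rewrite rooted_adj_diff //; apply/negP => /and3P[/eqP eu /eqP ev Gij].
by have := cA i j Gij; rewrite -eu -ev => /(_ uA); rewrite vA.
Qed.

Lemma rooted_independentU1 K A i (v : V i) : v != x i ->
  independent (rooted_product K H x) A ->
  independent (rooted_product K H x) (tg i v |: A) =
  independent (H i) (v |: component A i).
Proof.
move=> vx iA; have /rooted_independentP[iAi cA] := iA.
rewrite !independentU1 iA iAi; apply/forall_inP/forall_inP => [h u|h [j u] uA].
  by rewrite inE => /h; rewrite rooted_adj_same.
have [eij|ij] := eqVneq i j.
  move: eij u uA => <- u uA; rewrite rooted_adj_same; apply: h; by rewrite inE.
by rewrite rooted_adj_diff // (negPf vx).
Qed.

(** Only the root can be blocked from outside its component. So the part of A in H_i is a facet of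
    H_i if it contains the root, and otherwise a facet of H_i - x_i, to which the hypothesis
    applies. *)
Lemma rooted_facet_component K A i :
    (forall E : {set V i}, facet (induced_complex (H i) (setT :\ x i)) E ->
       facet (indep_complex (H i)) E) ->
  facet (indep_complex (rooted_product K H x)) A ->
  facet (indep_complex (H i)) (component A i).
Proof.
move=> sh; rewrite -!icT => /facet_icP[_ iA Amax].
have /rooted_independentP[iAi cA] := iA.
have cmax v : v != x i -> v \notin component A i ->
    ~~ independent (H i) (v |: component A i).
  move=> vx vA; rewrite -(rooted_independentU1 vx iA).
  by apply: Amax; rewrite ?inE // -mem_component.
have [xA|xA] := boolP (x i \in component A i).
  apply/facet_icP; split=> // v _ vA; apply: cmax => //.
  by apply: contraNneq vA => ->.
rewrite icT; apply: sh; apply/facet_icP; split=> //.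
  by rewrite subsetD1 subsetT.
by move=> v /setD1P[vx _]; apply: cmax.
Qed.

Lemma rooted_pure K :
    (forall i, graph_pure (H i)) ->
    (forall i (E : {set V i}), facet (induced_complex (H i) (setT :\ x i)) E ->
       facet (indep_complex (H i)) E) ->
  graph_pure (rooted_product K H x).
Proof.
move=> pH sh F F' fF fF'; rewrite !card_component; apply: eq_bigr => i _.
exact: pH (rooted_facet_component (@sh i) fF) (rooted_facet_component (@sh i) fF').
Qed.

Lemma rooted_vd_disjoint K U : (forall i, x i \notin U i) ->
  (forall i, vertex_decomposable (induced_complex (H i) (U i))) ->
  vertex_decomposable (induced_complex (rooted_product K H x) (assemble U)).
Proof.
move=> xU vU; pose on (r : seq 'I_m) i := if i \in r then U i else set0.
suff vr (r : seq 'I_m) : uniq r -> vertex_decomposable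
    (induced_complex (rooted_product K H x) (assemble (on r))).
  have := vr _ (enum_uniq 'I_m); congr (vertex_decomposable (induced_complex _ _)).
  by apply/setP=> -[i v]; rewrite !mem_assemble /on mem_enum.
elim: r => [_|i r IH /= /andP[ir /IH{}IH]].
  apply: vd_simplex; rewrite (_ : assemble _ = set0) ?independent_set0 //.
  by apply/setP=> -[i v]; rewrite mem_assemble !inE.
have -> : assemble (on (i :: r)) = tg i @: U i :|: assemble (on r).
  apply/setP=> -[j v]; rewrite in_setU !mem_assemble /on inE.
  have [eji|ji] := eqVneq j i.
    move: v; rewrite {}eji (negPf ir) => v.
    by rewrite in_set0 /= orbF (mem_imset _ _ (@Tagged_inj i)).
  apply/esym/orb_idl => /imsetP[u _ /(congr1 tag)/= e].
  by rewrite e eqxx in ji.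
apply: (vd_disjoint_union (G1 := H i) (@Tagged_inj i)) => //.
- by move=> a b; apply: rooted_adj_same.
- by move=> a aU; rewrite mem_assemble /on (negPf ir) inE.
move=> a [j b] aU; rewrite mem_assemble /on; case: ifP => [jr bU|]; last by rewrite inE.
rewrite rooted_adj_diff; last by apply: contraNneq ir => ->.
by apply: contraNN (xU i) => /and3P[/eqP <-].
Qed.

Lemma rooted_vd K :
    (forall i, shedding_vertex (indep_complex (H i)) (x i)) ->
  vertex_decomposable (indep_complex (rooted_product K H x)).
Proof.
move=> sh; set Gam := rooted_product K H x.
have vl i : vertex_decomposable (induced_complex (H i) (residual (H i) setT [set x i])).
  by rewrite -ic_link ?inE // icT; case: (sh i).
have vd i : vertex_decomposable (induced_complex (H i) (setT :\ x i)).
  by rewrite -ic_del icT; case: (sh i).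
have shd i : sheds (H i) setT (x i).
  by apply/shedsP; rewrite ?inE // icT; case: (sh i).
have -> : indep_complex Gam = induced_complex Gam (assemble (fun=> setT)).
  rewrite -icT; congr induced_complex; apply/setP=> -[i v].
  by rewrite mem_assemble !inE.
(* S is the set of components still intact; the others have lost their roots and are vertex
   decomposable. Each shedding step makes S smaller. *)
suff vS (S : {set 'I_m}) U : (forall i, i \in S -> U i = setT) ->
    (forall i, i \notin S ->
       x i \notin U i /\ vertex_decomposable (induced_complex (H i) (U i))) ->
    vertex_decomposable (induced_complex Gam (assemble U)).
  by apply: (vS setT) => i; rewrite inE.
have [n] := ubnP #|S|; elim: n S U => // n IH S U lt_n US UnS.
have [S0|/set0Pn[i iS]] := eqVneq S set0.
  by apply: rooted_vd_disjoint => i; case: (UnS i); rewrite ?S0 ?inE.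
have UiT := US i iS.
apply: (@vd_shed _ _ _ (tg i (x i))); first by rewrite mem_assemble UiT inE.
(* In the link of x_i, the component H_i loses the closed neighbourhood of its root, and every
   component adjacent to i in K loses just its root. *)
- pose U' j := if j == i then residual (H j) setT [set x j]
               else if K i j then U j :\ x j else U j.
  rewrite (_ : residual _ _ _ = assemble U').
    apply: (IH (S :\: (i |: [set j | K i j]))).
    + rewrite -ltnS; apply: leq_trans lt_n; rewrite ltnS; apply: proper_card.
      apply/properP; split; first exact: subsetDl.
      by exists i => //; rewrite !inE eqxx.
    + move=> j; rewrite !inE negb_or => /andP[/andP[/negPf ji /negPf Gij] jS].
      by rewrite /U' ji Gij US.
    + move=> j; rewrite /U'; have [->|ji] := eqVneq j i.
        by rewrite mem_residual1 eqxx andbF.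
      have [Gij _|Gij] := ifPn.
        split; first by rewrite !inE eqxx.
        have [/US->|/UnS[xj vj]] := boolP (j \in S); first exact: vd.
        by rewrite (_ : U j :\ x j = U j) //; apply/setDidPl;
          rewrite disjoint_sym disjoints1.
      rewrite !inE negb_or ji Gij /=; exact: UnS.
  apply/setP=> -[j v]; rewrite mem_residual1 !mem_assemble /U'.
  have [eji|ji] := eqVneq j i.
    move: v; rewrite {}eji => v; rewrite mem_residual1 UiT rooted_adj_same.
    by rewrite !inE eq_Tagged.
  have ne : tg j v != tg i (x i).
    by apply/negP => /eqP/(congr1 tag)/= e; rewrite e eqxx in ji.
  have eG : Gam (tg i (x i)) (tg j v) = (v == x j) && K i j.
    by rewrite rooted_adj_diff 1?eq_sym // eqxx.
  transitivity ((v \in U j) && ~~ ((v == x j) && K i j)).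
    by rewrite -eG; congr (_ && _); apply: andb_idl => _; exact: ne.
  by case: ifP; rewrite ?inE ?andbT ?andbF ?andbT // andbC.
- pose U' j := if j == i then U j :\ x j else U j.
  rewrite (_ : assemble U :\ _ = assemble U').
    apply: (IH (S :\ i)).
    + by move: lt_n; rewrite (cardsD1 i) iS.
    + by move=> j /setD1P[/negPf ji jS]; rewrite /U' ji US.
    + move=> j; rewrite /U' !inE negb_and negbK; have [->|ji /=] := eqVneq j i.
        by rewrite UiT !inE eqxx; split=> //; apply: vd.
      exact: UnS.
  apply/setP=> -[j v]; rewrite in_setD1 !mem_assemble /U'.
  have [eji|ji] := eqVneq j i.
    by move: v; rewrite {}eji => v; rewrite !inE eq_Tagged.
  apply: andb_idl => _.
  by apply/negP => /eqP/(congr1 tag)/= e; rewrite e eqxx in ji.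
move=> F /facet_icP[FU iF Fmax]; have /rooted_independentP[iFi cF] := iF.
have xF : x i \notin component F i.
  by rewrite mem_component; apply/negP => /(subsetP FU); rewrite !inE eqxx.
(* Vertices of H_i other than the root have all their neighbours in H_i, so maximality of F can be
   tested there, and shedding in H_i applies. *)
have : facet (induced_complex (H i) (setT :\ x i)) (component F i).
  apply/facet_icP; split=> //; first by rewrite subsetD1 subsetT.
  move=> v /setD1P[vx _] vF; rewrite -(rooted_independentU1 vx iF).
  apply: Fmax; last by rewrite -mem_component.
  by rewrite in_setD1 mem_assemble UiT inE eq_Tagged vx.
move/shd; apply: contra => /rooted_independentP[h _]; apply: independent_sub (h i).
apply/subsetP => v; rewrite !inE => /predU1P[->|->]; rewrite ?eqxx ?orbT //.
Qed.

End RootedProductComplexes.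

Lemma facet_nonmember (V : finType) (G : sgraph V) (C : {set V}) v :
  facet (indep_complex G) C -> v \notin C -> exists2 b, b \in C & G v b.
Proof.
rewrite -icT => /facet_icP[_ iC Cmax] vC; have := Cmax v (in_setT v) vC.
by rewrite independentU1 iC => /forall_inPn[b bC]; rewrite negbK; exists b.
Qed.

Lemma connected_neighbor (V : finType) (G : sgraph V) (x v : V) :
  graph_connected G -> v != x -> exists y, G x y.
Proof.
move=> conn vx; have /connectP[[|y p] /=] := conn x v.
  by move=> _ e; rewrite e eqxx in vx.
by move=> /andP[xy _] _; exists y.
Qed.

Lemma facet_through (V : finType) (G : sgraph V) (v : V) :
  exists2 F, facet (indep_complex G) F & v \in F.
Proof.
have : [set v] \in indep_complex G by rewrite mem_indep independent_set1.
by move=> /facet_ext[F fF]; rewrite sub1set; exists F.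
Qed.

Lemma facet_avoiding (V : finType) (G : sgraph V) (x y : V) : G x y ->
  exists2 F, facet (indep_complex G) F & x \notin F.
Proof.
move=> xy; have [F fF yF] := facet_through G y; exists F => //.
move: fF; rewrite -icT => /facet_icP[_ /independentP iF _].
by apply: contraTN xy => xF; apply: iF.
Qed.

(** * From (S_2) of the rooted products back to the factors *)

Section EdgeGraphs.
Variable I : finType.

Lemma edge_graph_sym (i j : I) :
  ssrbool.symmetric (fun a b => (a == i) && (b == j) || (a == j) && (b == i)).
Proof. by move=> a b; rewrite orbC andbC [X in _ || X]andbC. Qed.

Lemma edge_graph_irr (i j : I) : i != j ->
  irreflexive (fun a b => (a == i) && (b == j) || (a == j) && (b == i)).
Proof.
move=> /negPf ij a; have [->|] := eqVneq a i; first by rewrite ij.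
by rewrite andbF.
Qed.

Definition edge_graph (i j : I) (ij : i != j) : sgraph I :=
  SGraph (edge_graph_sym i j) (edge_graph_irr ij).

Lemma empty_graph_sym : ssrbool.symmetric (fun _ _ : I => false). Proof. by []. Qed.
Lemma empty_graph_irr : irreflexive (fun _ _ : I => false). Proof. by []. Qed.

Definition empty_graph : sgraph I := SGraph empty_graph_sym empty_graph_irr.

End EdgeGraphs.

Section Converse.
Variables (m : nat) (V : 'I_m -> finType).
Variables (H : forall i, sgraph (V i)) (x : forall i, V i).
Local Notation tg i := (@Tagged _ i V).

Lemma root_facets : exists B : forall i, {set V i}, forall i,
  facet (indep_complex (H i)) (B i) /\ x i \in B i.
Proof.
have ex i : exists B, facet (indep_complex (H i)) B && (x i \in B).
  by have [F fF xF] := facet_through (H i) (x i); exists F; rewrite fF.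
by exists (fun i => xchoose (ex i)) => i; apply/andP; apply: (xchooseP (ex i)).
Qed.

Lemma component_assemble (U : forall i, {set V i}) i :
  component (assemble U) i = U i.
Proof. by apply/setP=> v; rewrite mem_component mem_assemble. Qed.

Lemma facet_independent i (B : {set V i}) :
  facet (indep_complex (H i)) B -> independent (H i) B.
Proof. by rewrite -icT => /facet_icP[]. Qed.

(** Take the link of the union of facets of the H_j, j different from i, through their roots. It
    consumes all other components and deletes x_i exactly when i has a neighbour in K. The union is
    independent because every edge of K contains i. *)
Lemma rooted_serre2_component (K : sgraph 'I_m) i :
  (forall a b, K a b -> a = i \/ b = i) ->
  serre2_on (rooted_product K H x) setT ->
  serre2_on (H i) [set v | (v != x i) || ~~ [exists j, K i j]].
Proof.
move=> Ki sG; have [B HB] := root_facets.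
pose A := assemble (fun j => if j == i then set0 else B j).
have iA : independent (rooted_product K H x) A.
  apply/rooted_independentP; split=> [j|a b Kab].
    rewrite component_assemble; case: ifP => _; first exact: independent_set0.
    by case: (HB j) => /facet_independent.
  rewrite !mem_assemble; case: eqP => [_|ai]; first by rewrite inE.
  by case: eqP => [_|bi]; [rewrite inE|case: (Ki a b Kab)].
have := serre2_residual sG (subsetT A) iA; set U := [set v | _].
rewrite (_ : residual _ _ _ = tg i @: U); last first.
  apply/setP=> -[j v]; rewrite mem_residual // in_setT andTb.
  have [eji|ji] := eqVneq j i.
    move: v; rewrite {}eji => v; rewrite (mem_imset _ _ (@Tagged_inj _ _ i)).
    rewrite mem_assemble eqxx in_set0 inE [~~ false]/= andTb; apply/forall_inP/idP.
      move=> nA; apply: contraT; rewrite negb_or !negbK.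
      move=> /andP[/eqP ev /existsP[l Kil]].
      have li : l != i by apply: contraTneq Kil => ->; rewrite adj_irr.
      have lA : tg l (x l) \in A.
        by rewrite mem_assemble (negPf li); case: (HB l).
      have : ~~ rooted_product K H x (tg i v) (tg l (x l)) by apply: nA.
      by rewrite ev rooted_adj_diff 1?eq_sym // !eqxx Kil.
    move=> vU [l b]; rewrite mem_assemble; have [_|li _] := eqVneq l i.
      by rewrite inE.
    rewrite rooted_adj_diff 1?eq_sym //.
    apply: contraL vU => /and3P[/eqP<- _ Kil].
    by rewrite eqxx negbK; apply/existsP; exists l.
  rewrite mem_assemble (negPf ji); transitivity false.
    apply/negP => /andP[vB /forall_inP nA]; have [fB _] := HB j.
    have [b bB] := facet_nonmember fB vB; rewrite -(rooted_adj_same H x K).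
    by apply/negP/nA; rewrite mem_assemble (negPf ji).
  by apply/esym/imsetP => -[u _ /(congr1 tag)/= e]; rewrite e eqxx in ji.
by apply: serre2_imset; [exact: Tagged_inj|exact: rooted_adj_same].
Qed.

(** If H_i were the single vertex x_i, there would be two kinds of facets: [F1] contains x_i and
    avoids x_j, [F2] contains x_j and hence omits x_i. By purity of the factors they agree in size
    on all other components, so they differ by one, against purity of the product. *)
Lemma rooted_serre2_nontrivial i j (ij : i != j) y : H j (x j) y ->
  (forall l, serre2_on (H l) setT) ->
  serre2_on (rooted_product (edge_graph ij) H x) setT ->
  exists v : V i, v != x i.
Proof.
move=> xy sH sG; apply/existsP; apply: contraT; rewrite negb_exists => /forallP Vi.
have {}Vi v : v = x i by apply/eqP; have := Vi v; rewrite negbK.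
have [B HB] := root_facets.
have exA l : exists A : {set V l}, facet (indep_complex (H l)) A &&
    ([exists y, H l (x l) y] ==> (x l \notin A)).
  have [/existsP[z xz]|_] := boolP [exists y, H l (x l) y]; last first.
    by have [F fF _] := facet_through (H l) (x l); exists F; rewrite fF.
  by have [F fF xF] := facet_avoiding xz; exists F; rewrite fF.
pose A l := xchoose (exA l).
have fA l : facet (indep_complex (H l)) (A l) by case/andP: (xchooseP (exA l)).
have xA : x j \notin A j.
  have /andP[_ /implyP] := xchooseP (exA j); apply; apply/existsP; by exists y.
pose Gam := rooted_product (edge_graph ij) H x.
pose C l := if l == j then A l else B l.
have fC l : facet (indep_complex (H l)) (C l).
  by rewrite /C; case: ifP => _ //; case: (HB l).
have maximal (D : forall l, {set V l}) l (v : V l) :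
    facet (indep_complex (H l)) (D l) -> tg l v \notin assemble D ->
    ~~ independent Gam (tg l v |: assemble D).
  move=> fD; rewrite mem_assemble => /(facet_nonmember fD)[b bD vb].
  rewrite independentU1 negb_and; apply/orP; right; apply/forall_inPn.
  by exists (tg l b); rewrite ?mem_assemble // negbK rooted_adj_same.
pose F1 := assemble (fun l => if l == i then [set x l] else C l).
pose F2 := assemble (fun l => if l == i then set0 else B l).
have ji : (j == i) = false by rewrite eq_sym (negPf ij).
have f1 : facet (induced_complex Gam setT) F1.
  apply/facet_icP; split; first exact: subsetT.
    apply/rooted_independentP; split=> [l|a b].
      rewrite component_assemble; case: ifP => _; first exact: independent_set1.
      exact: facet_independent.
    rewrite /= !mem_assemble => /orP[]/andP[/eqP-> /eqP->].
      by rewrite eqxx ji /C eqxx (negPf xA).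
    by rewrite ji /C eqxx (negPf xA).
  move=> [l v] _ lF; apply: maximal => //; have [eli|//] := eqVneq l i.
  move: v lF; rewrite {}eli => v; rewrite (Vi v) mem_assemble eqxx inE eqxx.
  by [].
have f2 : facet (induced_complex Gam setT) F2.
  apply/facet_icP; split; first exact: subsetT.
    apply/rooted_independentP; split=> [l|a b].
      rewrite component_assemble; case: ifP => _; first exact: independent_set0.
      by case: (HB l) => /facet_independent.
    rewrite /= !mem_assemble => /orP[]/andP[/eqP-> /eqP->]; rewrite eqxx ?inE //.
  move=> [l v] _ lF; have [eli|li] := eqVneq l i; last first.
    by apply: maximal => //; rewrite (negPf li); case: (HB l).
  move: v lF; rewrite {}eli => v _; rewrite (Vi v) independentU1 negb_and.
  apply/orP; right; apply/forall_inPn; exists (tg j (x j)).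
    by rewrite mem_assemble ji; case: (HB j).
  by rewrite negbK rooted_adj_diff // !eqxx /= !eqxx.
have := serre2_pure sG f1 f2; rewrite !card_component.
rewrite (bigD1 i) //= [in RHS](bigD1 i) //= !component_assemble eqxx cards1 cards0.
rewrite (eq_bigr (fun l => #|component F2 l|)) => [|l li].
  by move/eqP; rewrite add0n -[X in _ == X]add0n eqn_add2r.
rewrite !component_assemble (negPf li).
apply: serre2_pure (sH l) _ _; rewrite icT //; by case: (HB l).
Qed.

(** A facet of H_i avoiding the root, obtained through y, is also a facet of H_i - x_i. As both
    graphs are pure, their facets have the same size, so a facet of H_i - x_i cannot be enlarged by
    the root. The link and the deletion lie in the at most 5 remaining vertices. *)
Lemma shedding_of_serre2 i y : H i (x i) y -> #|V i| <= 6 ->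
  serre2_on (H i) setT -> serre2_on (H i) (setT :\ x i) ->
  shedding_vertex (indep_complex (H i)) (x i).
Proof.
move=> xy V6 sT sx.
have small (U : {set V i}) : x i \notin U -> #|U| <= 5.
  move=> xU; have := max_card (mem (x i |: U)); rewrite cardsU1 xU.
  by move=> h; rewrite -ltnS; apply: leq_trans h V6.
have sr := serre2_residual sT (subsetT [set x i]) (independent_set1 (H i) (x i)).
have sh : sheds (H i) setT (x i).
  move=> F fF; have [N fN xN] := facet_avoiding xy.
  have fN' : facet (induced_complex (H i) (setT :\ x i)) N.
    move: fN; rewrite -icT => /facet_icP[_ iN Nmax]; apply/facet_icP; split=> //.
      by rewrite subsetD1 subsetT.
    by move=> v _; apply: Nmax; rewrite inE.
  have xF : x i \notin F.
    by have /facet_icP[/subsetP FU _ _] := fF; apply/negP => /FU; rewrite !inE eqxx.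
  apply/negP => ixF; have : x i |: F \in indep_complex (H i) by rewrite mem_indep.
  move=> /facet_ext[M]; rewrite -icT in fN *; move=> fM /subset_leq_card.
  by rewrite cardsU1 xF (serre2_pure sT fM fN) (serre2_pure sx fF fN') ltnn.
split.
- by rewrite mem_indep independent_set1.
- rewrite -icT ic_link ?inE //; apply: serre2_small_vd sr (small _ _).
  by rewrite mem_residual1 eqxx andbF.
- rewrite -icT ic_del; apply: serre2_small_vd sx (small _ _).
  by rewrite !inE eqxx.
- by have := proj1 (@shedsP _ (H i) _ _ (in_setT (x i))) sh; rewrite icT.
Qed.

Lemma rooted_serre2_shedding (k : fieldType) : 2 <= m ->
  (forall i, graph_connected (H i)) -> (exists i u v, H i u v) ->
  (forall i, #|V i| <= 6) ->
  (forall K : sgraph 'I_m, serre2_on (rooted_product K H x) setT) ->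
  forall i, [/\ two_pure k (H i) (x i), vertex_decomposable (indep_complex (H i))
    & shedding_vertex (indep_complex (H i)) (x i)].
Proof.
move=> m2 conn [j0 [u0 [v0 uv0]]] V6 sG i.
have sH l : serre2_on (H l) setT.
  have := @rooted_serre2_component (empty_graph 'I_m) l _ (sG _).
  rewrite (_ : [set v | _] = setT); first by apply.
  by apply/setP=> v; rewrite !inE; apply/orP; right; apply/existsP => -[].
(* By connectedness it suffices that H_i has a second vertex. If not, the component with an edge is
   another one, its root has a neighbour, and joining the two roots contradicts purity. *)
have [y xy] : exists y, H i (x i) y.
  suff [v vx] : exists v : V i, v != x i by apply: connected_neighbor vx.
  have [/existsP//|] := boolP [exists v, v != x i].
  rewrite negb_exists => /forallP Vi; have {}Vi v : v = x i.
    by apply/eqP; have := Vi v; rewrite negbK.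
  have ij : i != j0.
    apply/eqP => eij; move: u0 v0 uv0; rewrite -eij => u v.
    by rewrite (Vi u) (Vi v) adj_irr.
  have [w wx] : exists w, w != x j0.
    have [eu|ux] := eqVneq u0 (x j0); last by exists u0.
    by exists v0; apply: contraTneq uv0 => ->; rewrite eu adj_irr.
  have [z xz] := connected_neighbor (conn j0) wx.
  exact: rooted_serre2_nontrivial xz sH (sG (edge_graph ij)).
have [j ij] : exists j, i != j.
  have : 0 < #|predC1 i| by rewrite cardC1 card_ord -subn1 subn_gt0.
  by case/card_gt0P => j; rewrite inE eq_sym; exists j.
(* With the single edge from i to j as G_0, the link of the other components removes exactly the
   root x_i. *)
have sx : serre2_on (H i) (setT :\ x i).
  have := @rooted_serre2_component (edge_graph ij) i _ (sG _).
  rewrite (_ : [set v | _] = setT :\ x i).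
    apply=> a b /= /orP[]/andP[/eqP-> /eqP->]; by [left|right].
  apply/setP=> v; rewrite !inE andbT -[RHS]orbF; congr (_ || _).
  by apply/negbTE; rewrite negbK; apply/existsP; exists j; rewrite /= !eqxx.
have sh := shedding_of_serre2 xy (V6 i) (sH i) sx.
have pH : graph_pure (H i).
  by move=> F F'; rewrite -icT; apply: serre2_pure.
split=> //; last by case: sh => xD vl vd fac; apply: VDshed xD vl vd fac.
split=> //; first exact: graph_pure_del_vertex.
apply/del_same_dimP => F; rewrite -mem_indep => /facet_ext[M fM FM].
have [N fN xN] := facet_avoiding xy; exists N; split=> //.
  exact: facet_independent.
by rewrite -(pH _ _ fM fN) subset_leq_card.
Qed.

End Converse.

Theorem theorem4p3 (k : fieldType) (m : nat) (m_ge2 : 2 <= m)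
    (V : 'I_m -> finType) (H : forall i, sgraph (V i)) (x : forall i, V i)
    (H_connected : forall i, graph_connected (H i))
    (H_edge : exists i u v, H i u v)
    (H_small : forall i, #|V i| <= 6) :
  [<->
       (forall i, [/\ two_pure k (H i) (x i),
          vertex_decomposable (indep_complex (H i))
        & shedding_vertex (indep_complex (H i)) (x i)]);
       (forall G0 : sgraph 'I_m,
          graph_pure (rooted_product G0 H x) /\
          vertex_decomposable (indep_complex (rooted_product G0 H x)));
       (forall G0 : sgraph 'I_m,
          graph_cohen_macaulay k (rooted_product G0 H x));
       (forall G0 : sgraph 'I_m, graph_serre k (rooted_product G0 H x) 2)].
Proof.
tfae=> [sh G0|vd G0|cm G0|s2].
- split; last by apply: rooted_vd => i; case: (sh i).
  apply: rooted_pure => [i|i E]; first by case: (sh i) => -[].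
  by case: (sh i) => _ _ [_ _ _ fac]; rewrite -ic_del icT => /fac.
- by case: (vd G0) => pG vG; apply: vertex_decomposable_cohen_macaulay.
- exact: cohen_macaulay_serre.
- apply: rooted_serre2_shedding => // K.
  exact: graph_serre_serre2_on (s2 K).
Qed.
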